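(* Let $n\ge1$ and let $X$ be a compact metric space with finite covering dimension. Then every free topological dynamical system $(X,\mathbb H_{2n+1}(\mathbb Z)\times G)$ has finite topological Rokhlin dimension, where $\mathbb H_{2n+1}(\mathbb Z)$ is the discrete Heisenberg group and $G$ is any of: a finite group, a finitely generated abelian group, a locally finite group, or a countable group satisfying (WAFC) with a symmetric Følner sequence.
   Context: All groups are countable and discrete; $e$ is the identity. A topological dynamical system $(X,\Gamma)$ is an action of $\Gamma$ on $X$ by homeomorphisms $x\mapsto gx$; it is free if $gx\ne x$ for all $x$ and all $g\ne e$. $\mathbb H_{2n+1}(\mathbb Z)$ is $\mathbb Z^n\times\mathbb Z^n\times\mathbb Z$ with $(a,b,c)(a',b',c')=(a+a',b+b',c+c'+a\cdot b')$. A Følner sequence in $G$ is an increasing sequence $\{F_n\}_{n\ge1}$ of finite subsets with $e\in F_n$, $\bigcup_nF_n=G$, and $\lim_n|gF_n\triangle F_n|/|F_n|=0$ for all $g\in G$; symmetric means $F_n=F_n^{-1}$ for all $n$. A finite $A\subset G$ is a (weakly) approximate group with respect to a natural number $L>0$ if $e\in A$ and $A^{-1}A\subset\bigcup_{i=1}^Lg_iA$ for some $g_1,\dots,g_L\in G$; $L_A$ is the smallest such $L$. $(G,\{F_n\})$ satisfies (WAFC) if $\{F_n\}$ is a Følner sequence, every $F_n$ is an approximate group, and there is a natural number $L_G$ with $L_{F_n}\le L_G$ for all $n$. Topological Rokhlin dimension: for a compact metric space $X$ and a countable amenable group $\Gamma$, $\dim_{\rm Rok}(X,\Gamma)$ is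 the smallest $D\in\mathbb N\cup\{0\}$ (if it exists; otherwise it is infinite) such that there is a Følner sequence $\{F_n\}$ in $\Gamma$ such that for every $n\in\mathbb N$ there exist open $U_0,\dots,U_D\subset X$ with: (i) for every $0\le i\le D$, the sets $g\overline{U_i}$, $g\in F_n$, are pairwise disjoint; (ii) $\bigcup_{0\le i\le D}\bigcup_{g\in F_n}gU_i=X$. *)

(* Defs.v *)
From HB Require Import structures.
From mathcomp Require Import all_boot all_order all_algebra finmap.
From mathcomp Require Import all_classical all_reals all_analysis.
From mathcomp Require Import ring.

Set Implicit Arguments.
Unset Strict Implicit.
Unset Printing Implicit Defensive.

Import Order.TTheory GRing.Theory Num.Theory.
Import numFieldNormedType.Exports.

Local Open Scope classical_set_scope.
Local Open Scope ring_scope.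

(* Triples (a, b, c). The alias keeps the group law apart from the
   componentwise one that the library puts on products. *)
Definition heisenberg (n : nat) : Type := ('rV[int]_n * 'rV[int]_n * int)%type.

HB.instance Definition _ (n : nat) := Choice.on (heisenberg n).

Section HeisenbergGroup.
Variable n : nat.
Implicit Types x y z : heisenberg n.

Definition dotz (a b : 'rV[int]_n) : int := \sum_(i < n) a 0 i * b 0 i.

Definition heis_one : heisenberg n := (0, 0, 0).

Definition heis_mul x y : heisenberg n :=
  (x.1.1 + y.1.1, x.1.2 + y.1.2, x.2 + y.2 + dotz x.1.1 y.1.2).

Definition heis_inv x : heisenberg n :=
  (- x.1.1, - x.1.2, dotz x.1.1 x.1.2 - x.2).

Let dotzDl a a' b : dotz (a + a') b = dotz a b + dotz a' b.
Proof.
by rewrite /dotz -big_split; apply: eq_bigr => i _; rewrite /= mxE mulrDl.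
Qed.

Let dotzDr a b b' : dotz a (b + b') = dotz a b + dotz a b'.
Proof.
by rewrite /dotz -big_split; apply: eq_bigr => i _; rewrite /= mxE mulrDr.
Qed.

Let dotz0l b : dotz 0 b = 0.
Proof. by rewrite /dotz big1// => i _; rewrite mxE mul0r. Qed.

Let dotz0r a : dotz a 0 = 0.
Proof. by rewrite /dotz big1// => i _; rewrite mxE mulr0. Qed.

Let dotzNl a b : dotz (- a) b = - dotz a b.
Proof. by apply/eqP; rewrite -addr_eq0 -dotzDl addNr dotz0l. Qed.

Let dotzNr a b : dotz a (- b) = - dotz a b.
Proof. by apply/eqP; rewrite -addr_eq0 -dotzDr addNr dotz0r. Qed.

Lemma heis_mulA : associative heis_mul.
Proof.
move=> [[a b] c] [[a' b'] c'] [[a'' b''] c'']; rewrite /heis_mul /= !addrA.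
by congr (_, _, _); rewrite dotzDl dotzDr; ring.
Qed.

Lemma heis_mul1 : left_id heis_one heis_mul.
Proof. by move=> [[a b] c]; rewrite /heis_mul /= !add0r dotz0l addr0. Qed.

Lemma heis_mulr1 : right_id heis_one heis_mul.
Proof. by move=> [[a b] c]; rewrite /heis_mul /= !addr0 dotz0r addr0. Qed.

Lemma heis_mulV : left_inverse heis_one heis_inv heis_mul.
Proof.
by move=> [[a b] c]; rewrite /heis_mul /= !addNr subrK dotzNl subrr.
Qed.

Lemma heis_mulrV : right_inverse heis_one heis_inv heis_mul.
Proof.
move=> [[a b] c]; rewrite /heis_mul /= !subrr dotzNr.
by congr (_, _, _); ring.
Qed.

HB.instance Definition _ := isGroup.Build (heisenberg n)
  heis_mulA heis_mul1 heis_mulr1 heis_mulV heis_mulrV.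

End HeisenbergGroup.

Section GroupNotions.
Variable G : groupType.
Implicit Types (A : {fset G}) (F : nat -> {fset G}) (L : nat).

Definition is_subgroup (H : set G) : Prop :=
  [/\ H 1%g,
      forall x y, H x -> H y -> H (x * y)%g &
      forall x, H x -> H (x^-1)%g].

Definition gen_subgroup (S : set G) : set G := smallest is_subgroup S.

Definition fin_gen : Prop :=
  exists2 S : set G, finite_set S & gen_subgroup S = setT.

Definition is_abelian : Prop := forall x y : G, (x * y = y * x)%g.

Definition locally_finite : Prop :=
  forall S : set G, finite_set S -> finite_set (gen_subgroup S).

Definition ltrans (g : G) A : {fset G} := [fset (g * x)%g | x in A]%fset.

Definition symdiff A B : {fset G} := ((A `\` B) `|` (B `\` A))%fset.

(* Sequences indexed by n >= 1 are shifted to start at 0, the n-th term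
   being F n.-1. *)
Definition folner_sequence (R : realType) F : Prop :=
  [/\ forall n, (F n `<=` F n.+1)%fset,
      forall n, 1%g \in F n,
      \bigcup_n [set` F n] = [set: G] &
      forall g, (fun n => #|` symdiff (ltrans g (F n)) (F n)|%:R
                          / #|` F n|%:R : R) @ \oo --> (0 : R)].

Definition symmetric_sequence F : Prop :=
  forall n, F n = [fset (x^-1)%g | x in F n]%fset.

Definition approx_group_wrt A L : Prop :=
  [/\ (0 < L)%N, 1%g \in A &
      exists g : 'I_L -> G,
        [set (x^-1 * y)%g | x in [set` A] & y in [set` A]]
          `<=` \bigcup_i [set` ltrans (g i) A]].

Definition approx_group A : Prop := exists L, approx_group_wrt A L.

(* L_A; the value is 0 when A is not an approximate group. *)
Definition approx_const A : nat :=
  xget 0%N [set L | approx_group_wrt A L /\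
                    forall L', approx_group_wrt A L' -> (L <= L')%N].

Definition WAFC (R : realType) F : Prop :=
  [/\ folner_sequence R F,
      forall n, approx_group (F n) &
      exists LG : nat, forall n, (approx_const (F n) <= LG)%N].

End GroupNotions.

(* Lebesgue covering dimension at most d: every open cover has an open
   refinement in which no point lies in more than d + 1 members. *)
Definition covering_dim_le (X : topologicalType) (d : nat) : Prop :=
  forall U : set (set X), U `<=` open -> \bigcup_(A in U) A = setT ->
  exists V : set (set X),
    [/\ V `<=` open,
        \bigcup_(B in V) B = setT,
        forall B, V B -> exists2 A, U A & B `<=` A &
        forall x, ([set B | V B /\ B x] #<= `I_d.+1)%card].

Definition finite_covering_dim (X : topologicalType) : Prop :=
  exists d, covering_dim_le X d.

Definition homeomorphism (X : topologicalType) (f : X -> X) : Prop :=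
  continuous f /\ exists2 h, continuous h & cancel f h /\ cancel h f.

Record dynsys (X : topologicalType) (Gamma : groupType) := Dynsys {
  dynsys_act :> Gamma -> X -> X;
  dynsys_act1 : forall x, dynsys_act 1%g x = x;
  dynsys_actM : forall g h x,
    dynsys_act (g * h)%g x = dynsys_act g (dynsys_act h x);
  dynsys_homeo : forall g, homeomorphism (dynsys_act g) }.

Section Rokhlin.
Variables (R : realType) (X : topologicalType) (Gamma : groupType).
Variable T : dynsys X Gamma.

Definition free_system : Prop :=
  forall (x : X) (g : Gamma), g <> 1%g -> T g x <> x.

Definition rokhlin_dim_prop (D : nat) : Prop :=
  exists2 F : nat -> {fset Gamma}, folner_sequence R F &
  forall n, exists U : 'I_D.+1 -> set X,
    [/\ forall i, open (U i),
        forall i, trivIset [set` F n] (fun g => T g @` closure (U i)) &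
        \bigcup_i \bigcup_(g in [set` F n]) (T g @` U i) = setT].

(* The smallest D with the above property, and +oo if there is none (the
   infimum of a nonempty set of naturals is attained). *)
Definition rokhlin_dim : \bar R :=
  ereal_inf [set D%:R%:E | D in rokhlin_dim_prop].

End Rokhlin.

(* Main.v *)
Require Import Defs.
From HB Require Import structures.
From mathcomp Require Import all_boot all_order all_algebra finmap.
From mathcomp Require Import all_classical all_reals all_analysis.
From mathcomp Require Import zify ring lra.

(** Two ingredients are combined: finite subsets of the group with small doubling,
    and the covering dimension of the space.

    On the group side, the product of the Heisenberg group with [G] has
    a symmetric Folner sequence [F] such that [F i F i] is covered by a number
    [L] of translates of [F i] that does not depend on [i]
    ([doubling_folner]). This property passes to products
    ([doubling_folnerM]). For [G] locally finite one takes finite subgroups; the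
    remaining groups that are not covered by assumption, namely the Heisenberg
    group and finitely generated abelian groups, have polynomial growth.
    A filtration of polynomial growth is doubling at arbitrarily large scales,
    and then it has an almost flat step near such a scale, where a ball is at the
    same time almost invariant and, by Ruzsa's covering argument, covered as
    required ([polynomial_growth_doubling]).

    On the dynamical side, let [A] be one of the sets [F i]. If [X] were
    zero-dimensional, one would choose a maximal clopen set [U] without returns in
    [A ^ 8], then another one among the points outside [A A U], and so
    on. A point left over after [Q] rounds would have [Q] return times in
    [A ^ 8] that are separated by [A A], so that [Q * #|A|] is at most [#|A ^ 9|],
    which is at most [L ^ 8 * #|A|]. Hence the number of rounds is
    bounded by [L] alone, and so is the number of towers ([tower_family]).

    In general these sets are not clopen. They are made by finitely many Boolean
    operations from translates of the sets of an initial cover by superlevel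
    sets of functions, hence all is well at a point unless one of the functions
    vanishes at one of finitely many translates of this point. If [X] has
    dimension at most [d], one takes [d.+1] independent copies of this
    construction and perturbs the functions so that this does not happen to all
    copies at the same point: a common zero of [d.+1] functions on [X] is unstable
    ([no_common_zero], [generic_families]). Thus every point is
    covered by the towers of one of the copies ([towers_cover]). *)

Set Implicit Arguments.
Unset Strict Implicit.
Unset Printing Implicit Defensive.

Import Order.TTheory GRing.Theory Num.Theory.
Import numFieldNormedType.Exports.

Local Open Scope classical_set_scope.
Local Open Scope ring_scope.

(** * Counting in finite subsets of a group *)

Lemma fcard_leq (T : choiceType) (A B : {fset T}) :
  {subset A <= B} -> (#|` A| <= #|` B|)%N.
Proof. by move=> AB; apply: fsubset_leq_card; apply/fsubsetP. Qed.

Lemma card_fsetM (T U : choiceType) (A : {fset T}) (B : {fset U}) :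
  #|` (A `*` B)%fset| = (#|` A| * #|` B|)%N.
Proof.
rewrite -(size_allpairs pair); apply/perm_size/uniq_perm.
- exact: fset_uniq.
- by apply: allpairs_uniq; rewrite ?fset_uniq// => -[? ?] [? ?].
- move=> [u v]; rewrite in_fsetM /=; apply/andP/allpairsP => [[uA vB]|].
    by exists (u, v).
  by move=> [[x y] /= [xA yB [-> ->]]].
Qed.

Lemma card_le_codom (T : finType) (U : choiceType) (f : T -> U) (A : {fset U}) :
  {subset A <= codom f} -> (#|` A| <= #|T|)%N.
Proof.
by move=> Af; rewrite -(size_codom f); apply: uniq_leq_size; first exact: fset_uniq.
Qed.

Section FiniteSets.
Variable G : groupType.
Implicit Types A B : {fset G}.

Definition mulfs A B : {fset G} := [fset (a * b)%g | a in A, b in B]%fset.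

Fixpoint powfs A k : {fset G} :=
  if k is k'.+1 then mulfs A (powfs A k') else [fset 1%g]%fset.

Lemma mulfsP A B x :
  reflect (exists2 a, a \in A & exists2 b, b \in B & x = (a * b)%g)
          (x \in mulfs A B).
Proof. exact: imfset2P. Qed.

Lemma mem_mulfs A B a b : a \in A -> b \in B -> (a * b)%g \in mulfs A B.
Proof. by move=> aA bB; apply/mulfsP; exists a => //; exists b. Qed.

Lemma powfsD A i j x y :
  x \in powfs A i -> y \in powfs A j -> (x * y)%g \in powfs A (i + j).
Proof.
elim: i x => [x /fset1P -> |i IHi x /mulfsP[a aA [b bi ->]] yj].
  by rewrite mul1g.
by rewrite -mulgA addSn; apply: mem_mulfs => //; exact: IHi.
Qed.

Lemma mem_powfs1 A x : (x \in powfs A 1) = (x \in A).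
Proof.
apply/mulfsP/idP => [[a aA [b /fset1P -> ->]]|xA]; first by rewrite mulg1.
by exists x => //; exists 1%g; rewrite ?mulg1// fset11.
Qed.

Lemma powfs_id A k : 1%g \in A -> 1%g \in powfs A k.
Proof.
move=> A1; elim: k => [|k IHk]; first exact: fset11.
by rewrite -[1%g]mulg1; exact: mem_mulfs.
Qed.

Lemma powfsV A k : (forall x, x \in A -> (x^-1)%g \in A) ->
  forall x, x \in powfs A k -> (x^-1)%g \in powfs A k.
Proof.
move=> AV; elim: k => [|k IHk] x; first by move/fset1P ->; rewrite invg1 fset11.
case/mulfsP => a aA [b bk ->]; rewrite invgM -addn1.
by apply: powfsD; [exact: IHk|rewrite mem_powfs1 AV].
Qed.

(** The translates [A r] of a symmetric set [A] by the points of an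
    [A A]-separated list are disjoint, so that they fit into [A R] only
    finitely often: every packing bound below comes from here. *)
Lemma card_separated A B (rs : seq G) :
  (forall x, x \in A -> (x^-1)%g \in A) -> {subset rs <= B} ->
  pairwise (fun r s => (r * s^-1)%g \notin mulfs A A) rs ->
  (size rs * #|` A| <= #|` mulfs A B|)%N.
Proof.
move=> AV rsB sep; rewrite mulnC.
have -> : (#|` A| * size rs)%N = size [seq (a * r)%g | r <- rs, a <- A].
  by rewrite size_allpairs mulnC.
apply: uniq_leq_size; last first.
  by move=> _ /allpairsP[[r a] /= [rrs aA ->]]; apply: mem_mulfs => //; exact: rsB.
elim: rs sep {rsB} => [//|r rs IHrs] /= /andP[/allP rsep /IHrs uniq_rs].
rewrite cat_uniq uniq_rs andbT map_inj_uniq ?fset_uniq; last exact: mulIg.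
apply/hasPn => _ /allpairsP[[s a] /= [srs aA ->]].
apply/mapP => -[b bA] eq_as; have /negP[] := rsep s srs.
have -> : (r * s^-1 = b^-1 * a)%g.
  by apply: (mulgI b); rewrite mulgA -eq_as mulgK mulVKg.
by apply: mem_mulfs => //; exact: AV.
Qed.

Lemma max_separated (E : rel G) (s : seq G) : reflexive E -> symmetric E ->
  exists hs, [/\ {subset hs <= s}, pairwise (fun x y => ~~ E x y) hs &
    forall x, x \in s -> exists2 h, h \in hs & E x h].
Proof.
move=> Exx Esym; elim: s => [|x s [hs [hss hsep hmax]]]; first by exists [::].
have [/hasP[h hhs Exh]|/hasPn nE] := boolP (has (E x) hs).
  exists hs; split=> // [y /hss|y]; rewrite inE; first by move=> ->; rewrite orbT.
  by case/predU1P => [->|/hmax//]; exists h.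
exists (x :: hs); split=> [y||y].
- by rewrite !inE => /predU1P[->|/hss ->]; rewrite ?eqxx ?orbT.
- by rewrite /= hsep andbT; apply/allP.
- rewrite inE => /predU1P[->|/hmax[h hhs Eyh]]; first by exists x; rewrite ?inE ?eqxx.
  by exists h => //; rewrite inE hhs orbT.
Qed.

(** Iterating the covering relation [A A <= A h] bounds all powers of [A]. *)
Lemma powfs_cover A (h : seq G) L : (size h <= L)%N ->
  (forall x y, x \in A -> y \in A ->
     exists2 z, z \in h & (x * y * z^-1)%g \in A) ->
  forall k, exists2 w : seq G, (size w <= L ^ k)%N &
    forall x, x \in powfs A k.+1 -> exists2 z, z \in w & (x * z^-1)%g \in A.
Proof.
move=> hL hcov; elim=> [|k [w wL wcov]].
  exists [:: 1%g] => // x; rewrite mem_powfs1 => xA.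
  by exists 1%g; rewrite ?inE// invg1 mulg1.
exists [seq (z * y)%g | z <- h, y <- w].
  by rewrite size_allpairs expnS leq_mul.
move=> _ /mulfsP[a aA [x /wcov[y yw xyA] ->]].
have [z zh azA] := hcov _ _ aA xyA.
exists (z * y)%g; first exact: allpairs_f.
by rewrite invgM !mulgA -(mulgA a).
Qed.

Lemma card_powfs_le A (h : seq G) L : (size h <= L)%N ->
  (forall x y, x \in A -> y \in A ->
     exists2 z, z \in h & (x * y * z^-1)%g \in A) ->
  forall k, (#|` powfs A k.+1| <= L ^ k * #|` A|)%N.
Proof.
move=> hL hcov k; have [w wL wcov] := powfs_cover hL hcov k.
apply: (@leq_trans (size [seq (a * z)%g | z <- w, a <- A])).
  apply: uniq_leq_size => [|x /wcov[z zw xzA]]; first exact: fset_uniq.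
  by rewrite -[x](mulgVK z); apply: (allpairs_f (fun z a => (a * z)%g)).
by rewrite size_allpairs leq_mul2r wL orbT.
Qed.

End FiniteSets.

(** * Folner sequences with uniform doubling *)

Section Doubling.
Variable G : groupType.
Implicit Types (A : {fset G}) (F : nat -> {fset G}).

(** For symmetric [A] this is the condition on weakly approximate groups, turned
    into a covering by right translates: if [A A] is covered by the [A z] with
    [z] in [h], then the sets [A A U] that maximality yields are covered by towers
    of shape [A] with the bases [z U]. *)
Definition doubling A L := exists2 h : seq G, (size h <= L)%N &
  forall x y, x \in A -> y \in A ->
    exists2 z, z \in h & (x * y * z^-1)%g \in A.

Definition doubling_folner (R : realType) := exists F L,
  [/\ folner_sequence R F,
      forall i x, x \in F i -> (x^-1)%g \in F i &
      forall i, doubling (F i) L].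

Lemma in_ltrans g A x : (x \in ltrans g A) = ((g^-1 * x)%g \in A).
Proof.
apply/imfsetP/idP => [[y yA ->]|gxA]; first by rewrite mulKg.
by exists (g^-1 * x)%g => //; rewrite mulVKg.
Qed.

Lemma card_ltrans g A : #|` ltrans g A| = #|` A|.
Proof. by rewrite card_imfset//; exact: mulgI. Qed.

End Doubling.

Lemma cvg_ratio0P (R : realType) (a b : nat -> nat) :
  (forall i, 0 < b i)%N ->
  ((fun i => (a i)%:R / (b i)%:R : R) @ \oo --> (0 : R)) <->
  (forall k, \forall i \near \oo, (a i * k <= b i)%N).
Proof.
move=> b0; split=> [ab0 k|abk].
  have : 0 < (k.+1%:R^-1 : R) by rewrite invr_gt0 ltr0n.
  move/cvgrPdist_le : ab0 => /[apply]; apply: filterS => i.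
  rewrite sub0r normrN ger0_norm ?divr_ge0// ler_pdivrMr ?ltr0n//.
  rewrite mulrC ler_pdivlMr ?ltr0n// -natrM ler_nat; apply: leq_trans.
  by rewrite leq_mul2l leqnSn orbT.
apply/cvgrPdist_le => e e0.
have [k ke] : exists k, e^-1 <= k.+1%:R.
  by exists (Num.bound e^-1); apply/ltW/(lt_le_trans (archi_boundP _));
    rewrite ?invr_ge0 ?(ltW e0)// ler_nat.
apply: filterS (abk k.+1) => i /= abi.
rewrite sub0r normrN ger0_norm ?divr_ge0// ler_pdivrMr ?ltr0n//.
rewrite -ler_pdivrMl//; apply: (@le_trans _ _ ((a i)%:R * k.+1%:R)).
  by rewrite mulrC ler_wpM2l.
by rewrite -natrM ler_nat.
Qed.

(** The Folner condition without real numbers, so that the boundaries can be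
    estimated by counting. *)
Lemma folner_sequenceP (R : realType) (G : groupType) (F : nat -> {fset G}) :
  [/\ forall n, (F n `<=` F n.+1)%fset, forall n, 1%g \in F n &
      \bigcup_n [set` F n] = [set: G]] ->
  folner_sequence R F <->
  (forall g k, \forall i \near \oo,
    (#|` symdiff (ltrans g (F i)) (F i)| * k <= #|` F i|)%N).
Proof.
move=> [Fmon F1 FT].
have F0 i : (0 < #|` F i|)%N by rewrite cardfs_gt0; apply/fset0Pn; exists 1%g.
split=> [[_ _ _ Fg] g|Fg]; first by apply/(cvg_ratio0P R).
by split=> // g; apply/cvg_ratio0P.
Qed.

Section Product.
Variables (R : realType) (G H : groupType).

Lemma card_symdiffM (A : {fset G}) (B : {fset H}) g h :
  (#|` symdiff (ltrans ((g, h) : (G * H)%type) (A `*` B)%fset) (A `*` B)%fset| <=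
   #|` symdiff (ltrans g A) A| * (2 * #|` B|) +
   (2 * #|` A|) * #|` symdiff (ltrans h B) B|)%N.
Proof.
pose S := ((symdiff (ltrans g A) A) `*` (ltrans h B `|` B))%fset.
pose S' := ((ltrans g A `|` A) `*` (symdiff (ltrans h B) B))%fset.
apply: (@leq_trans #|` (S `|` S')%fset|); last first.
  rewrite (leq_trans (leq_card_fsetU _ _))// !card_fsetM leq_add//.
    by rewrite leq_mul2l (leq_trans (leq_card_fsetU _ _)) ?orbT// card_ltrans addnn mul2n.
  by rewrite leq_mul2r (leq_trans (leq_card_fsetU _ _)) ?orbT// card_ltrans addnn mul2n.
apply: fcard_leq => -[u v].
rewrite !inE !in_ltrans /=.
have -> : ((g, h)^-1 * (u, v))%g = ((g^-1 * u)%g, (h^-1 * v)%g) by [].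
by rewrite !inE /=; do 4 case: (_ \in _).
Qed.

(** The boundaries of the factors add up and their covering numbers multiply. *)
Lemma doubling_folnerM : doubling_folner G R -> doubling_folner H R ->
  doubling_folner (G * H)%type R.
Proof.
move=> [F [L [FF FV FL]]] [F' [L' [FF' FV' FL']]].
have [Fmon F1 FT _] := FF; have [Fmon' F1' FT' _] := FF'.
exists (fun i => F i `*` F' i)%fset, (L * L')%N; split.
- apply/folner_sequenceP.
    split=> [i|i|].
    + apply/fsubsetP => -[u v]; rewrite !inE /= => /andP[uF vF].
      by rewrite (fsubsetP (Fmon i))// (fsubsetP (Fmon' i)).
    + by rewrite inE /= F1 F1'.
    + rewrite -subTset => -[u v] _.
      have [i _ /= ui] : (\bigcup_n [set` F n]) u by rewrite FT.
      have [j _ /= vj] : (\bigcup_n [set` F' n]) v by rewrite FT'.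
      have mon (T : choiceType) (E : nat -> {fset T}) k l :
          (forall n, (E n `<=` E n.+1)%fset) -> (k <= l)%N ->
          {subset E k <= E l}.
        move=> Emon; elim: l => [|l IHl]; first by rewrite leqn0 => /eqP ->.
        rewrite leq_eqVlt => /predU1P[->//|/IHl kl x /kl].
        exact/fsubsetP.
      exists (maxn i j) => //=; rewrite inE /=.
      by rewrite (mon _ F i)// ?leq_maxl// (mon _ F' j)// leq_maxr.
  move=> [g h] k.
  have Fg := (folner_sequenceP R (And3 Fmon F1 FT)).1 FF g (4 * k)%N.
  have Fh := (folner_sequenceP R (And3 Fmon' F1' FT')).1 FF' h (4 * k)%N.
  apply: filterS2 Fg Fh => i.
  set s := #|` _| => sF; set s' := #|` _| => sF'.
  apply: leq_trans (_ : ((s * (2 * #|` F' i|) + 2 * #|` F i| * s') * k <= _)%N).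
    by rewrite leq_mul2r card_symdiffM orbT.
  by rewrite card_fsetM; nia.
- move=> i [u v]; rewrite !inE /= => /andP[uF vF].
  by rewrite FV// FV'.
- move=> i; have [h hL hcov] := FL i; have [h' hL' hcov'] := FL' i.
  exists [seq (z, z') | z <- h, z' <- h']; first by rewrite size_allpairs leq_mul.
  move=> [x x'] [y y']; rewrite !inE /= => /andP[xF xF'] /andP[yF yF'].
  have [z zh xyz] := hcov _ _ xF yF; have [z' zh' xyz'] := hcov' _ _ xF' yF'.
  exists (z, z'); first exact: allpairs_f.
  by rewrite !inE /= xyz.
Qed.

End Product.

(** A finite subgroup is covered by the single translate [1], and it absorbs every
    translation by one of its elements. *)
Lemma locally_finite_doubling (R : realType) (G : groupType) :
  countable [set: G] -> locally_finite G -> doubling_folner G R.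
Proof.
move=> Gcount Glf.
have /countable_injP[f f_inj] := Gcount.
pose S i := f @^-1` `I_i.
have SF i : finite_set (gen_subgroup (S i)).
  by apply: Glf; apply: finite_preimage => // x y _ _; apply: f_inj; rewrite inE.
pose F i := fset_set (gen_subgroup (S i)).
have FP i x : (x \in F i) <-> gen_subgroup (S i) x.
  by rewrite in_fset_set// inE.
have subgroupF i : is_subgroup (gen_subgroup (S i)).
  split=> [H [[]]//|x y Hx Hy H sub|x Hx H sub].
    by case: (sub) => -[_ HM _] _; apply: HM; [exact: Hx|exact: Hy].
  by case: (sub) => -[_ _ HV] _; apply: HV; exact: Hx.
have SmonF i j : (i <= j)%N -> {subset F i <= F j}.
  move=> ij x /FP xi; apply/FP => H [Hsub SH]; apply: xi; split=> //.
  by move=> g /= gi; apply: SH; exact: leq_trans ij.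
have SS i g : (f g < i)%N -> g \in F i by move=> gi; apply/FP => H [_]; exact.
exists F, 1%N; split.
- apply/folner_sequenceP; first split=> [i|i|].
  + by apply/fsubsetP; apply: SmonF.
  + by apply/FP; case: (subgroupF i).
  + by rewrite -subTset => g _; exists (f g).+1 => //=; apply: SS.
  move=> g k; exists (f g).+1 => // i /= /SS /FP gi.
  have [_ FM FV] := subgroupF i.
  suff -> : symdiff (ltrans g (F i)) (F i) = fset0 by rewrite cardfs0 mul0n.
  have -> : ltrans g (F i) = F i.
    apply/fsetP => x; rewrite in_ltrans; apply/idP/idP => /FP xi; apply/FP.
      by rewrite -(mulVKg g x); apply: FM.
    by apply: FM => //; exact: FV.
  by rewrite /symdiff fsetDv fsetUid.
- by move=> i x /FP xi; apply/FP; case: (subgroupF i) => _ _; apply.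
- move=> i; exists [:: 1%g] => // x y /FP xi /FP yi; exists 1%g; rewrite ?inE//.
  by rewrite invg1 mulg1; apply/FP; case: (subgroupF i) => _ + _; apply.
Qed.

Lemma finite_locally_finite (G : groupType) :
  finite_set [set: G] -> locally_finite G.
Proof. by move=> Gfin S _; exact: sub_finite_set Gfin. Qed.

Lemma WAFC_doubling (R : realType) (G : groupType) (F : nat -> {fset G}) :
  WAFC R F -> symmetric_sequence F -> doubling_folner G R.
Proof.
move=> [FF Fapp [L FL]] Fsym.
have FV i x : x \in F i -> (x^-1)%g \in F i.
  by move=> xF; rewrite Fsym; apply/imfsetP; exists x.
exists F, L; split=> // i; have := FL i; rewrite /approx_const.
case: xgetP => [l _ [[_ _ [g gF]] _] lL|nex _]; last first.
  have [l0 l0F] := Fapp i; exfalso.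
  have exl : exists l, `[< approx_group_wrt (F i) l >] by exists l0; apply/asboolP.
  have [l /asboolP lF lmin] := ex_minnP exl.
  by apply: (nex l); split=> // l' ?; apply: lmin; exact/asboolP.
exists [seq (g k)^-1%g | k : 'I_l]; first by rewrite size_map size_enum_ord.
move=> x y xF yF.
(* the covering of [A^-1 A] by left translates is turned around by inversion *)
have /gF[k _ /=] : [set (u^-1 * v)%g | u in [set` F i] & v in [set` F i]]
    (x * y)^-1%g.
  by exists y => //; exists x^-1%g; [exact: FV|rewrite invgM].
rewrite in_ltrans => kF; exists (g k)^-1%g.
  by apply/mapP; exists k; rewrite ?mem_enum.
by have := FV _ _ kF; rewrite invgM !invgK.
Qed.

(** * Groups of polynomial growth *)

(** A sequence of polynomial growth cannot be multiplied by more than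
    [8 ^ D.+1] at all large scales, since this would give the growth exponent
    [D.+1]. *)
Lemma polynomial_doubling_scale (b : nat -> nat) C D :
  (forall i, 0 < b i)%N -> (forall i, b i <= C * i.+1 ^ D)%N ->
  forall N, exists2 n, (N <= n)%N & (b (8 * n) <= 8 ^ D.+1 * b n)%N.
Proof.
move=> b0 bC N; apply: contrapT => nex.
have bgt n : (N <= n)%N -> (8 ^ D.+1 * b n < b (8 * n))%N.
  by move=> Nn; rewrite ltnNge; apply/negP => bn; apply: nex; exists n.
have iter k : ((8 ^ D.+1) ^ k <= b (8 ^ k * N.+1))%N.
  elim: k => [|k IHk]; first by rewrite expn0 b0.
  rewrite (expnS (8 ^ D.+1)) (expnS 8 k) -(mulnA 8 (8 ^ k)%N).
  apply: leq_trans _ (ltnW (bgt _ _)); last first.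
    by rewrite (leq_trans (leqnSn N))// leq_pmull// expn_gt0.
  by rewrite leq_mul2l IHk orbT.
pose K := (C * N.+2 ^ D)%N.
have : ((8 ^ D.+1) ^ K <= K * (8 ^ K) ^ D)%N.
  apply: leq_trans (iter K) _; apply: leq_trans (bC _) _.
  rewrite -mulnA leq_mul2l -expnMn; apply/orP; right.
  have : (0 < 8 ^ K)%N by rewrite expn_gt0.
  by case: D {bC bgt iter nex} K => [|D] K K0; rewrite ?expn0// leq_exp2r//; nia.
have -> : ((8 ^ D.+1) ^ K = 8 ^ K * (8 ^ K) ^ D)%N.
  by rewrite -!expnM -expnD -mulnS mulnC.
rewrite leq_mul2r.
by rewrite !expn_eq0 /= leqNgt ltn_expl.
Qed.

(** Bernoulli's inequality for [(t.+2 / t.+1) ^ S], cleared of denominators. *)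
Lemma bernoulli_nat t S : (t.+1 ^ S * (t.+1 + S) <= t.+1 * t.+2 ^ S)%N.
Proof.
elim: S => [|S IHS]; first by rewrite !expn0; lia.
rewrite !expnS; set x := (t.+1 ^ S)%N in IHS *; set y := (t.+2 ^ S)%N in IHS *.
have : (x <= y)%N by rewrite /x /y; case: S {IHS x y} => // S; rewrite leq_exp2r.
by nia.
Qed.

(** If the sequence gains at most a factor [K] over a range of [K * t.+1] steps
    of length [t.+1], then some step gains at most the factor [t.+2 / t.+1]:
    otherwise Bernoulli's inequality would give the factor [K.+1]. *)
Lemma flat_step (b : nat -> nat) (K t m : nat) :
  (0 < b m)%N -> (forall i, m <= i -> i <= m + K * t.+1 * t.+1 -> b i <= K * b m)%N ->
  exists2 i, (m <= i <= m + K * t.+1 * t.+1)%N &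
             (b (i + t.+1) * t.+1 <= b i * t.+2)%N.
Proof.
move=> bm bK; apply: contrapT => nex.
pose S := (K * t.+1)%N.
have step s : (s <= S)%N -> (b m * t.+2 ^ s <= b (m + s * t.+1) * t.+1 ^ s)%N.
  elim: s => [|s IHs] sS; first by rewrite mul0n addn0.
  have {}IHs := IHs (ltnW sS).
  have : (b (m + s * t.+1) * t.+2 < b (m + s * t.+1 + t.+1) * t.+1)%N.
    rewrite ltnNge; apply/negP => le; apply: nex; exists (m + s * t.+1)%N => //.
    by rewrite leq_addr leq_add2l leq_mul2r orbC ltnW.
  rewrite mulSn (addnC t.+1) addnA !expnS.
  move: IHs; move: (t.+1 ^ s)%N (t.+2 ^ s)%N => x y; nia.
have /(leq_trans (step S (leqnn _))) : 
    (b (m + S * t.+1) * t.+1 ^ S <= K * b m * t.+1 ^ S)%N.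
  by rewrite leq_mul2r bK ?orbT// leq_addr.
have := bernoulli_nat t S.
have : (0 < t.+1 ^ S)%N by rewrite expn_gt0.
rewrite {1}/S; move: (t.+1 ^ S)%N (t.+2 ^ S)%N => x y; rewrite /S; nia.
Qed.

Section PolynomialGrowth.
Variables (R : realType) (G : groupType) (B : nat -> {fset G}) (C D : nat).
Hypothesis B1 : forall i, 1%g \in B i.
Hypothesis BM : forall i j x y,
  x \in B i -> y \in B j -> (x * y)%g \in B (i + j)%N.
Hypothesis BV : forall i x, x \in B i -> (x^-1)%g \in B i.
Hypothesis BT : forall x, exists i, x \in B i.
Hypothesis Bgrowth : forall i, (#|` B i| <= C * i.+1 ^ D)%N.

Let Bmon i j : (i <= j)%N -> {subset B i <= B j}.
Proof.
by move=> ij x xi; rewrite -(subnKC ij) -[x]mulg1; apply: BM.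
Qed.

Let Bcard i j : (i <= j)%N -> (#|` B i| <= #|` B j|)%N.
Proof. by move=> /Bmon; exact: fcard_leq. Qed.

Let B0 i : (0 < #|` B i|)%N.
Proof. by rewrite cardfs_gt0; apply/fset0Pn; exists 1%g. Qed.

Let mulfsB i j : {subset mulfs (B i) (B j) <= B (i + j)%N}.
Proof. by move=> _ /mulfsP[x xi [y yj ->]]; exact: BM. Qed.

(** Ruzsa's covering argument: the translates of [B n] by a maximal
    separated subset of [B (6 n)] pack into [B (7 n)], and those of
    [B (2 n)], hence of [B m], cover [B (6 n)], hence [B m B m]. *)
Let doubling_ball n m K : (2 * n <= m <= 3 * n)%N ->
  (#|` B (8 * n)%N| <= K * #|` B n|)%N -> doubling (B m) K.
Proof.
move=> /andP[nm mn] BK.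
pose E x y := (x * y^-1)%g \in mulfs (B n) (B n).
have Ex : reflexive E.
  by move=> x; rewrite /E mulgV -[1%g](mulg1 1%g); exact: mem_mulfs.
have Esub x y : E x y -> E y x.
  move=> /mulfsP[a an [b bn xy]]; apply/mulfsP.
  by exists b^-1%g; [exact: BV|exists a^-1%g; [exact: BV|rewrite -invgM -xy invgF]].
have Esym : symmetric E by move=> x y; apply/idP/idP; exact: Esub.
have [hs [hsB hsep hmax]] := max_separated (enum_fset (B (6 * n)%N)) Ex Esym.
exists hs.
  have := card_separated (BV (i := n)) hsB hsep.
  have : (#|` mulfs (B n) (B (6 * n))| <= #|` B (8 * n)%N|)%N.
    by apply/fcard_leq => x /mulfsB; apply: Bmon; lia.
  by move=> le1 /leq_trans/(_ (leq_trans le1 BK)); rewrite leq_pmul2r.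
move=> x y xm ym; have /hmax[h hh xyE] : (x * y)%g \in B (6 * n)%N.
  by apply: (Bmon (i := (m + m)%N)); [lia|exact: BM].
exists h => //; apply: (Bmon (i := (n + n)%N)); first by lia.
exact: mulfsB.
Qed.

(** Around a scale where the cardinality grows by a bounded factor there is room
    for an almost flat step, so both properties hold at once. *)
Let good_scale t N : exists m, [/\ (N <= m)%N, doubling (B m) (8 ^ D.+1) &
  (#|` B (m + t)%N| * t.+1 <= #|` B m| * t.+2)%N].
Proof.
pose K := (8 ^ D.+1)%N.
have [n Nn BK] := polynomial_doubling_scale B0 Bgrowth (N + K * t.+1 * t.+1)%N.
have range i : (2 * n <= i)%N -> (i <= 2 * n + K * t.+1 * t.+1)%N ->
    (#|` B i| <= K * #|` B (2 * n)%N|)%N.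
  move=> _ iin; apply: (@leq_trans #|` B (8 * n)%N|); first by apply: Bcard; lia.
  by apply: leq_trans BK _; rewrite leq_mul2l Bcard ?orbT//; lia.
have [i /andP[ni iin] flat] := flat_step (B0 _) range.
exists i; split; first lia.
  by apply: (doubling_ball (n := n)) BK; apply/andP; split; lia.
by apply: leq_trans flat; rewrite leq_mul2r Bcard ?orbT// leq_add2l.
Qed.

(** The balls of good scales form the sequence. Its consecutive scales are chosen
    with the flatness [i] at the [i]-th scale, which is what makes the
    boundaries negligible. *)
Lemma polynomial_growth_doubling : doubling_folner G R.
Proof.
have [f fP] := choice (fun p : nat * nat => good_scale p.1 p.2).
pose m := fix m i := if i is j.+1 then f (j.+1, (m j).+1) else f (0, 0)%N.
have mi i : (i <= m i)%N.
  by elim: i => //= i IHi; have [/(leq_ltn_trans IHi)] := fP (i.+1, (m i).+1).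
have mdbl i : doubling (B (m i)) (8 ^ D.+1)
  by case: i => [|i]; [case: (fP (0, 0)%N)|case: (fP (i.+1, (m i).+1))].
have mflat i : (#|` B (m i + i)%N| * i.+1 <= #|` B (m i)| * i.+2)%N.
  by case: i => [|i]; [case: (fP (0, 0)%N)|case: (fP (i.+1, (m i).+1))].
exists (fun i => B (m i)), (8 ^ D.+1)%N; split=> //; last by move=> i x; exact: BV.
apply/folner_sequenceP; first split=> // [i|].
- apply/fsubsetP/Bmon => /=; apply: ltnW; by case: (fP (i.+1, (m i).+1)).
- by rewrite -subTset => x _; have [i xi] := BT x; exists i => //=; apply: Bmon xi.
move=> g k; have [j gj] := BT g; exists (j + 2 * k)%N => // i /= ji.
pose S := (B (m i + i) `\` B (m i))%fset.
have BS : (B (m i) `<=` B (m i + i)%N)%fset by apply/fsubsetP/Bmon/leq_addr.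
have cS : #|` S| = (#|` B (m i + i)%N| - #|` B (m i)|)%N.
  by rewrite cardfsD (fsetIidPr BS).
have gi : g \in B i by apply: Bmon gj; lia.
have : (#|` symdiff (ltrans g (B (m i))) (B (m i))| <= 2 * #|` S|)%N.
  apply: (@leq_trans #|` (S `|` ltrans g S)%fset|).
    apply: fcard_leq => x; rewrite !inE !in_ltrans !inE.
    case/orP => /andP[xB gxB]; apply/orP; [left|right].
      by rewrite xB /= -(mulVKg g x) addnC; exact: BM.
    by rewrite xB /= addnC; apply: BM => //; exact: BV.
  by rewrite (leq_trans (leq_card_fsetU _ _))// card_ltrans addnn mul2n.
have := mflat i; have : #|` B (m i + i)%N| = (#|` B (m i)| + #|` S|)%N.
  by rewrite cS subnKC// Bcard// leq_addr.
move=> -> flat le_S; apply: (@leq_trans (#|` S| * i.+1)%N); last first.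
  by move: flat; rewrite mulnDl (mulnS _ i.+1) [leqLHS]addnC leq_add2r.
apply: (@leq_trans (2 * #|` S| * k)%N); first by rewrite leq_mul2r le_S orbT.
by rewrite mulnAC mulnC leq_mul2l; apply/orP; right; lia.
Qed.

End PolynomialGrowth.

(** * The Heisenberg group and finitely generated abelian groups *)

Section Heisenberg.
Variables (R : realType) (n : nat).
Hypothesis n_ge1 : (1 <= n)%N.
Local Notation H := (heisenberg n).
Implicit Types (a b : 'rV[int]_n) (x y : H) (i j N : nat).

Lemma dotzD a a' b b' :
  dotz (a + a') (b + b') = dotz a b + dotz a b' + dotz a' b + dotz a' b'.
Proof.
rewrite /dotz -!big_split; apply: eq_bigr => k _ /=; rewrite !mxE.
by rewrite mulrDl !mulrDr addrA.
Qed.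

Lemma dotzN a b : dotz (- a) (- b) = dotz a b.
Proof. by apply: eq_bigr => k _; rewrite !mxE mulrNN. Qed.

Lemma dotz_le a b i j : (forall k, `|a 0 k| <= i%:Z) ->
  (forall k, `|b 0 k| <= j%:Z) -> `|dotz a b| <= (n * (i * j))%N%:Z.
Proof.
move=> ai bj; apply: (le_trans (ler_norm_sum _ _ _)).
apply: (@le_trans _ _ (\sum_(k < n) (i * j)%N%:Z)).
  by apply: ler_sum => k _; rewrite normrM PoszM ler_pM.
by rewrite sumr_const card_ord -mulr_natl -natz -natrM natz.
Qed.

(** The central coordinate that is odd under inversion. In these coordinates
    the boxes of size [N], [N] and [n N ^ 2] are symmetric and multiply like the
    balls of a length function. *)
Definition heis_twist x : int := x.2 *+ 2 - dotz x.1.1 x.1.2.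

Definition heis_small N x : bool :=
  [&& [forall k, `|x.1.1 0 k| <= N%:Z], [forall k, `|x.1.2 0 k| <= N%:Z] &
      `|heis_twist x| <= (n * (N * N))%N%:Z].

Lemma heis_smallP N x : reflect
  [/\ forall k, `|x.1.1 0 k| <= N%:Z, forall k, `|x.1.2 0 k| <= N%:Z &
      `|heis_twist x| <= (n * (N * N))%N%:Z] (heis_small N x).
Proof.
by apply: (iffP and3P) => -[aN bN cN]; split=> //; exact/forallP.
Qed.

Lemma heis_smallM i j x y :
  heis_small i x -> heis_small j y -> heis_small (i + j)%N (x * y)%g.
Proof.
move=> /heis_smallP[xa xb xc] /heis_smallP[ya yb yc]; apply/heis_smallP.
have sum_le (u v : 'rV[int]_n) : (forall k, `|u 0 k| <= i%:Z) ->
    (forall k, `|v 0 k| <= j%:Z) -> forall k, `|(u + v) 0 k| <= (i + j)%N%:Z.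
  by move=> ui vj k; rewrite mxE (le_trans (ler_normD _ _))// PoszD lerD.
split; [exact: sum_le|exact: sum_le|].
have -> : heis_twist (x * y)%g = heis_twist x + heis_twist y +
    (dotz x.1.1 y.1.2 - dotz y.1.1 x.1.2).
  by rewrite /heis_twist /= dotzD; ring.
have xy := dotz_le xa yb; have yx := dotz_le ya xb.
apply: (le_trans (ler_normD _ _)).
apply: (le_trans (lerD (ler_normD _ _) (ler_normB _ _))).
move: xc yc xy yx; move: `|_| `|_| `|_| `|_| => p q r s; lia.
Qed.

Lemma heis_smallV N x : heis_small N x -> heis_small N (x^-1)%g.
Proof.
move=> /heis_smallP[xa xb xc]; apply/heis_smallP; split=> [k|k|].
- by rewrite mxE normrN.
- by rewrite mxE normrN.
- suff -> : heis_twist (x^-1)%g = - heis_twist x by rewrite normrN.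
  by rewrite /heis_twist /= dotzN; ring.
Qed.

Definition heis_decode N
    (t : {ffun 'I_n -> 'I_(2 * N).+1} * {ffun 'I_n -> 'I_(2 * N).+1} *
         'I_(2 * (n * (N * N))).+1) : H :=
  (\row_k ((t.1.1 k)%:Z - N%:Z), \row_k ((t.1.2 k)%:Z - N%:Z),
   t.2%:Z - (n * (N * N))%N%:Z).

Definition heis_box N : {fset H} :=
  [fset x in codom (@heis_decode N) | heis_small N x]%fset.

Lemma int_code N (z : int) : `|z| <= N%:Z ->
  exists k : 'I_(2 * N).+1, k%:Z - N%:Z = z.
Proof.
move=> zN; have kN : (absz (z + N%:Z)%R < (2 * N).+1)%N by lia.
by exists (Ordinal kN) => /=; lia.
Qed.

Lemma in_heis_box N x : (x \in heis_box N) = heis_small N x.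
Proof.
rewrite !inE /= andb_idl// => /heis_smallP[xa xb xc].
have row_code (a : 'rV[int]_n) : (forall k, `|a 0 k| <= N%:Z) ->
    exists u : {ffun 'I_n -> 'I_(2 * N).+1}, \row_k ((u k)%:Z - N%:Z) = a.
  move=> aN; have [f fP] := choice (fun k => int_code (aN k)).
  by exists (finfun f); apply/rowP => k; rewrite mxE ffunE fP.
have [u uP] := row_code _ xa; have [v vP] := row_code _ xb.
have xc2 : `|x.2| <= (n * (N * N))%N%:Z.
  have := dotz_le xa xb; move: xc; rewrite /heis_twist; lia.
have [w wP] := int_code xc2.
apply/codomP; exists (u, v, w).
by rewrite /heis_decode /= uP vP wP; case: (x) => -[].
Qed.

Lemma card_heis_box N :
  (#|` heis_box N| <= 2 ^ n * 2 ^ n * (2 * n).+1 * N.+1 ^ (n + n + 2))%N.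
Proof.
apply: (@leq_trans ((2 * N).+1 ^ n * (2 * N).+1 ^ n * (2 * (n * (N * N))).+1)%N).
  have /card_le_codom : {subset heis_box N <= codom (@heis_decode N)}.
    by move=> x; rewrite !inE => /andP[].
  by rewrite !card_prod !card_ffun !card_ord.
have pow_le : ((2 * N).+1 ^ n <= 2 ^ n * N.+1 ^ n)%N.
  by rewrite -expnMn leq_exp2r//; lia.
have c_le : ((2 * (n * (N * N))).+1 <= (2 * n).+1 * N.+1 ^ 2)%N.
  by rewrite expnS expn1; nia.
apply: leq_trans (leq_mul (leq_mul pow_le pow_le) c_le) _.
by rewrite !expnD; apply: eq_leq; ring.
Qed.

Lemma heisenberg_doubling : doubling_folner H R.
Proof.
have small1 N : heis_small N (1%g : H).
  apply/heis_smallP; split=> [k|k|]; rewrite ?mxE ?normr0//.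
  by rewrite /heis_twist /= /dotz big1 ?normr0// => k _; rewrite mxE mul0r.
apply: (@polynomial_growth_doubling _ _ heis_box _ _ _ _ _ _ card_heis_box).
- by move=> N; rewrite in_heis_box.
- by move=> i j x y; rewrite !in_heis_box; exact: heis_smallM.
- by move=> i x; rewrite !in_heis_box; exact: heis_smallV.
- move=> x; pose N := (absz (heis_twist x) + \sum_k absz (x.1.1 0%R k) +
                       \sum_k absz (x.1.2 0%R k))%N.
  exists N; rewrite in_heis_box; apply/heis_smallP.
  have le_sum (f : 'I_n -> nat) k : (f k <= \sum_k f k)%N.
    by rewrite (bigD1 k)//= leq_addr.
  split=> [k|k|].
  + rewrite -abszE lez_nat (leq_trans (le_sum (fun k => absz (x.1.1 0 k)) k))//.
    by rewrite /N -addnA addnCA leq_addr.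
  + rewrite -abszE lez_nat (leq_trans (le_sum (fun k => absz (x.1.2 0 k)) k))//.
    by rewrite /N leq_addl.
  + have : (absz (heis_twist x) <= N)%N by rewrite /N; lia.
    have : (N <= n * (N * N))%N by nia.
    by lia.
Qed.

End Heisenberg.

Section Abelian.
Variables (R : realType) (G : groupType).

(** Words of length [k] in commuting generators are determined by the number
    of occurrences of each generator. *)
Lemma card_powfs_abelian (S : {fset G}) k :
  is_abelian G -> (#|` powfs S k| <= k.+1 ^ #|` S|)%N.
Proof.
move=> Gab; pose word (e : {ffun S -> 'I_k.+1}) := (\prod_s val s ^+ e s)%g.
have powP x : x \in powfs S k ->
    exists2 e : S -> nat, (forall s, e s <= k)%N & x = (\prod_s val s ^+ e s)%g.
  elim: k x {word} => [|k IHk] x.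
    by move=> /fset1P ->; exists (fun=> 0%N) => //; rewrite big1.
  move=> /mulfsP[s sS [y /IHk[e ek ->] ->]].
  pose s0 : S := [` sS]%fset.
  exists (fun s => ((s == s0) + e s)%N) => [t|].
    by rewrite -add1n leq_add// leq_b1.
  have -> : s = (\prod_(t : S) val t ^+ (t == s0))%g.
    transitivity (\prod_(t | t == s0) val t)%g; first by rewrite big_pred1_eq.
    by rewrite big_mkcond; apply: eq_bigr => t _; case: eqP.
  rewrite -prodgM_commute; last by move=> ? ? _ _; exact: Gab.
  by apply: eq_bigr => t _; rewrite expgnDr.
rewrite [X in (_ <= _ ^ X)%N]cardfE -(card_ord k.+1) -card_ffun.
apply: (card_le_codom (f := word)) => x /powP[e ek ->].
apply/codomP; exists [ffun s => inord (e s)].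
by apply: eq_bigr => s _; rewrite ffunE inordK// ltnS.
Qed.

Lemma fin_gen_abelian_doubling : fin_gen G -> is_abelian G -> doubling_folner G R.
Proof.
move=> [S Sfin Sgen] Gab.
pose S1 := (1%g |` (fset_set S `|` [fset (x^-1)%g | x in fset_set S]))%fset.
have S1V x : x \in S1 -> (x^-1)%g \in S1.
  rewrite !inE => /or3P[/eqP ->|xS|/imfsetP[y /= yS ->]].
  - by rewrite invg1 eqxx.
  - by apply/or3P/Or33/imfsetP; exists x.
  - by rewrite invgK yS orbT.
have S11 : 1%g \in S1 by rewrite !inE eqxx.
apply: (@polynomial_growth_doubling _ _ (powfs S1) 1 #|` S1|).
- by move=> k; exact: powfs_id.
- by move=> i j x y; exact: powfsD.
- by move=> k x; exact: powfsV.
- have : gen_subgroup S `<=` [set x | exists k, x \in powfs S1 k].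
    apply: smallest_sub => [|x Sx]; last first.
      by exists 1%N; rewrite /= mem_powfs1 !inE in_fset_set// mem_set// orbT.
    split=> [|x y [i xi] [j yj]|x [i xi]]; first by exists 0%N; rewrite fset11.
      by exists (i + j)%N; exact: powfsD.
    by exists i; exact: powfsV.
  by rewrite Sgen => sub x; exact: sub.
- by move=> k; rewrite mul1n; exact: card_powfs_abelian.
Qed.

End Abelian.

(** * Towers away from the boundaries of a cover *)

Section Decided.
Variable X : topologicalType.
Implicit Types (S U : set X) (x : X).

(** [x] is not in the boundary of [S]. In this form the property passes at once
    to Boolean combinations and to preimages. *)
Definition decided S x := nbhs x S \/ nbhs x (~` S).

Lemma decided_nbhs S x : decided S x -> S x -> nbhs x S.
Proof. by case=> [//|/nbhs_singleton]. Qed.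

Lemma decidedC S x : decided S x -> decided (~` S) x.
Proof. by rewrite /decided setCK; case; [right|left]. Qed.

Lemma decidedI S U x : decided S x -> decided U x -> decided (S `&` U) x.
Proof.
move=> [Sx|Sx] Ux; last by right; apply: filterS Sx => y nS [].
case: Ux => Ux; first by left; exact: filterI.
by right; apply: filterS Ux => y nU [].
Qed.

Lemma decidedU S U x : decided S x -> decided U x -> decided (S `|` U) x.
Proof.
move=> /decidedC Sx /decidedC Ux; have := decidedC (decidedI Sx Ux).
by rewrite setCI !setCK.
Qed.

Lemma decided_all (I : eqType) (s : seq I) (S : I -> set X) x :
  (forall i, i \in s -> decided (S i) x) ->
  decided [set y | forall i, i \in s -> S i y] x.
Proof.
elim: s => [|i s IHs] dec; first by left; apply: filterE.
have -> : [set y | forall j, j \in i :: s -> S j y] =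
    S i `&` [set y | forall j, j \in s -> S j y].
  apply/seteqP; split=> [y Sy|y [Siy Ssy] j /predU1P[->//|/Ssy//]].
  by split=> [|j js]; apply: Sy; rewrite inE ?eqxx// js orbT.
apply: decidedI; first by apply: dec; rewrite inE eqxx.
by apply: IHs => j js; apply: dec; rewrite inE js orbT.
Qed.

Lemma decided_preimage (h : X -> X) S x :
  continuous h -> decided S (h x) -> decided (h @^-1` S) x.
Proof. by move=> hc [] /hc; [left|right]. Qed.

End Decided.

Section Towers.
Variables (X : topologicalType) (Gamma : groupType) (T : dynsys X Gamma).
Implicit Types (U Y : set X) (x : X) (g r e : Gamma).

Lemma act_continuous g : continuous (T g).
Proof. by case: (dynsys_homeo T g). Qed.

Lemma actK g : cancel (T g) (T g^-1%g).
Proof. by move=> x; rewrite -dynsys_actM mulVg dynsys_act1. Qed.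

Lemma actKV g : cancel (T g^-1%g) (T g).
Proof. by move=> x; rewrite -dynsys_actM mulgV dynsys_act1. Qed.

Definition no_returns (R : {fset Gamma}) U :=
  forall x r, r \in R -> U x -> U (T r x) -> r = 1%g.

Lemma sub_no_returns R U U' : U' `<=` U -> no_returns R U -> no_returns R U'.
Proof. by move=> U'U UR x r rR /U'U Ux /U'U; exact: UR. Qed.

Section Greedy.
Variables (R : {fset Gamma}) (V : nat -> set X) (K : nat).
Hypothesis R1 : 1%g \in R.
Hypothesis RV : forall r, r \in R -> (r^-1)%g \in R.
Hypothesis V_no_returns : forall j, (j < K)%N -> no_returns R (V j).

(** A set made from [R]-translates of the [V j] by [k] successive Boolean
    operations can have as boundary points only the points that are not
    [generic k]. *)
Definition generic k x := forall g, g \in powfs R k ->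
  forall j, (j < K)%N -> decided (V j) (T g x).

Definition decided_from k U := forall x, generic k x -> decided U x.

Lemma generic_act k r x : r \in R -> generic k.+1 x -> generic k (T r x).
Proof.
move=> rR xk g gk j jK; rewrite -dynsys_actM; apply: xk => //.
by rewrite -addn1; apply: powfsD => //; rewrite mem_powfs1.
Qed.

Lemma genericW k x : generic k.+1 x -> generic k x.
Proof. by move=> /(generic_act R1); rewrite dynsys_act1. Qed.

Lemma decided_from_avoid k U (E : {fset Gamma}) : {subset E <= R} ->
  decided_from k U ->
  decided_from k.+1 [set x | forall r, r \in E -> ~ U (T r x)].
Proof.
move=> ER Uk x xk.
apply: (@decided_all _ _ _ (fun r => ~` (T r @^-1` U))) => r rE.
apply/decidedC/decided_preimage; first exact: act_continuous.
by apply/Uk/generic_act => //; exact: ER.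
Qed.

(** Going through the [V j] in order and keeping of each the points whose
    orbit has not been met yet within [R]: a maximal subset of [Y] without
    returns. *)
Lemma greedy Y a J : (J <= K)%N -> decided_from a Y ->
  exists U, [/\ U `<=` Y, no_returns R U, decided_from (a + J) U &
    forall x j, Y x -> (j < J)%N -> V j x -> exists2 r, r \in R & U (T r x)].
Proof.
move=> + Ya; elim: J => [_|J IHJ JK].
  by exists set0; split=> // x _; right; rewrite setC0; exact: filterT.
have [U [UY UR Ua Umax]] := IHJ (ltnW JK).
pose N : set X := [set x | forall r, r \in R -> ~ U (T r x)].
exists (U `|` (Y `&` V J `&` N)); split.
- by move=> x [/UY|[[]]].
- move=> x r rR [Ux|[[_ Vx] Nx]] [Ux'|[[_ Vx'] Nx']].
  + exact: UR rR Ux Ux'.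
  + by case: (Nx' _ (RV rR)); rewrite actK.
  + by case: (Nx _ rR).
  + exact: V_no_returns rR Vx Vx'.
- move=> x; rewrite addnS => xk.
  have Wx := genericW xk; have mono k i : generic (k + i) x -> generic k x.
    by elim: i => [|i IHi]; rewrite ?addn0// addnS => /genericW.
  apply: decidedU; first exact: Ua.
  apply: decidedI; last exact: (@decided_from_avoid (a + J)).
  apply: decidedI; first by apply: Ya; exact: mono Wx.
  rewrite -[x](dynsys_act1 T); apply: xk => //.
  exact: powfs_id.
- move=> x j Yx; rewrite ltnS leq_eqVlt => /predU1P[->|jJ] Vx; last first.
    by have [r rR Ur] := Umax x j Yx jJ Vx; exists r => //; left.
  have [[r rR Ur]|nU] := pselect (exists2 r, r \in R & U (T r x)).
    by exists r => //; left.
  exists 1%g => //; rewrite dynsys_act1; right; split=> // r rR Ur.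
  by apply: nU; exists r.
Qed.

End Greedy.

Section TowerFamily.
Variables (A : {fset Gamma}) (h : seq Gamma) (L : nat).
Hypothesis A1 : 1%g \in A.
Hypothesis AV : forall a, a \in A -> (a^-1)%g \in A.
Hypothesis hL : (size h <= L)%N.
Hypothesis hcov : forall a b, a \in A -> b \in A ->
  exists2 z, z \in h & (a * b * z^-1)%g \in A.
Variables (V : nat -> set X) (K : nat).
Let R := powfs A 8.
Let E := mulfs A A.
Hypothesis V_no_returns : forall j, (j < K)%N -> no_returns R (V j).
Hypothesis V_cover : forall x, exists2 j, (j < K)%N & V j x.

Let memE e : (e \in E) = (e \in powfs A 2).
Proof.
apply/mulfsP/idP => [[a aA [b bA ->]]|/mulfsP[a aA [b + ->]]].
  by apply: (@powfsD _ A 1 1); rewrite mem_powfs1.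
by rewrite mem_powfs1 => bA; exists a => //; exists b.
Qed.

Let powfsW k l : (k <= l)%N -> {subset powfs A k <= powfs A l}.
Proof.
move=> kl g gk; rewrite -(subnKC kl) -[g]mulg1; apply: powfsD => //.
exact: powfs_id.
Qed.

Let R1 : 1%g \in R. Proof. exact: powfs_id. Qed.
Let RV r : r \in R -> (r^-1)%g \in R. Proof. exact: powfsV. Qed.
Let ER : {subset E <= R}.
Proof. by move=> e; rewrite memE; exact: powfsW. Qed.

(** Each round takes a maximal set without returns among the points not yet
    covered. A point left over after [Q] rounds returns, within [R], to all
    [Q] of these sets, at places which are [A A]-separated. *)
Let rounds Q : exists (U : nat -> set X) Y,
  [/\ forall q, (q < Q)%N ->
        no_returns R (U q) /\ decided_from R V K (Q * K.+1) (U q),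
      decided_from R V K (Q * K.+1) Y,
      forall x, Y x -> forall q e, (q < Q)%N -> e \in E -> ~ U q (T e x),
      forall x, ~ Y x -> exists2 q, (q < Q)%N & exists2 e, e \in E & U q (T e x) &
      forall x, Y x -> exists rs, [/\ size rs = Q, {subset rs <= R},
        pairwise (fun r s => (r * s^-1)%g \notin E) rs &
        forall r, r \in rs -> exists2 q, (q < Q)%N & U q (T r x)]].
Proof.
have mono k i x : generic R V K (k + i) x -> generic R V K k x.
  by elim: i => [|i IHi]; rewrite ?addn0// addnS => /genericW => /(_ R1).
elim: Q => [|Q [U [Y [UQ YQ YU nYU Yrs]]]].
  exists (fun=> set0), setT; split=> // x; first by left; exact: filterT.
    by case.
  by exists [::].
have [W [WY WR WQ Wmax]] := greedy R1 RV V_no_returns (leqnn K) YQ.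
pose U' q := if (q < Q)%N then U q else W.
have U'Q : U' Q = W by rewrite /U' ltnn.
have level : (Q.+1 * K.+1 = (Q * K.+1 + K).+1)%N by rewrite mulSn; lia.
exists U', (Y `&` [set x | forall e, e \in E -> ~ W (T e x)]); split.
- move=> q; rewrite ltnS leq_eqVlt => /predU1P[->|qQ]; rewrite ?U'Q /U' ?qQ level.
    by split=> // x /genericW => /(_ R1); exact: WQ.
  have [UR Ua] := UQ q qQ; split=> // x /genericW => /(_ R1) /mono.
  exact: Ua.
- move=> x; rewrite level => xk; apply: decidedI.
    by apply: YQ; move: xk => /genericW => /(_ R1) /mono.
  exact: (decided_from_avoid ER WQ).
- move=> x [Yx Wx] q e; rewrite ltnS leq_eqVlt => /predU1P[->|qQ] eE.
    by rewrite U'Q; exact: Wx.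
  by rewrite /U' qQ; exact: YU.
- move=> x nYx; have [Yx|/nYU[q qQ [e eE Ux]]] := pselect (Y x); last first.
    by exists q; [exact: ltnW|exists e => //; rewrite /U' qQ].
  exists Q => //; rewrite U'Q; apply: contrapT => nW; apply: nYx; split=> // e eE We.
  by apply: nW; exists e.
- move=> x [Yx Wx]; have [rs [rsQ rsR rsep rsU]] := Yrs x Yx.
  have [j jK Vx] := V_cover x; have [r rR Wr] := Wmax x j Yx jK Vx.
  exists (rcons rs r); split.
  + by rewrite size_rcons rsQ.
  + by move=> s; rewrite mem_rcons inE => /predU1P[->|/rsR].
  + rewrite pairwise_rcons rsep andbT; apply/allP => s srs.
    have [q qQ Us] := rsU s srs; apply/negP => srE.
    by apply: (YU _ (WY _ Wr) q _ qQ srE); rewrite -dynsys_actM mulgVK.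
  + move=> s; rewrite mem_rcons inE => /predU1P[->|/rsU[q qQ Us]].
      by exists Q; rewrite ?U'Q.
    by exists q; [exact: ltnW|rewrite /U' qQ].
Qed.

(** [(L ^ 8).+1] rounds of [K.+1] Boolean operations, and one more translation to
    reach the point that is covered. *)
Definition tower_level := ((L ^ 8).+1 * K.+1).+1.

(** [A A U q] covers [X] for the union over the rounds [q], and it is covered by
    the sets [A z U q] with [z] in [A ^ 3]. The set [z U q] has no returns in
    [A A] since [U q] has none in [z^-1 A A z], which lies in [A ^ 8]. The number
    of rounds exceeds the packing bound [#|A ^ 9| / #|A| <= L ^ 8]. At generic
    points the sets may be replaced by their interiors. *)
Lemma tower_family : exists W : nat -> set X,
  [/\ forall i, open (W i),
      forall i, no_returns E (W i) &
      forall x, generic R V K tower_level x ->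
        exists2 i, (i < (L ^ 8).+1 * L)%N & exists2 a, a \in A & W i (T a^-1%g x)].
Proof.
set Q := (L ^ 8).+1.
have [U [Y [UQ _ _ nYU Yrs]]] := rounds Q.
have Y0 x : ~ Y x.
  move=> /Yrs[rs [rsQ rsR rsep _]].
  have := leq_trans (card_separated AV rsR rsep) (card_powfs_le hL hcov 8).
  by rewrite rsQ leq_pmul2r ?ltnn// cardfs_gt0; apply/fset0Pn; exists 1%g.
(* the translations used in the covering can be taken in [A ^ 3] *)
pose h3 := [seq z <- h | z \in powfs A 3].
pose z p := nth 1%g h3 p.
have zA p : z p \in powfs A 3.
  have [ph|ph] := ltnP p (size h3); last by rewrite /z nth_default// powfs_id.
  by have := mem_nth 1%g ph; rewrite mem_filter => /andP[].
have zcov e : e \in E -> exists2 p, (p < L)%N & (e * (z p)^-1)%g \in A.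
  move=> /mulfsP[u uA [v vA ->]]; have [y yh uvy] := hcov uA vA.
  have yh3 : y \in h3.
    rewrite mem_filter yh andbT.
    have -> : (y = (u * v * y^-1)^-1 * (u * v))%g
      by rewrite !invgM invgK -!mulgA !mulKg mulVg mulg1.
    apply: (@powfsD _ A 1 2); first by rewrite mem_powfs1 AV.
    by rewrite -memE; exact: mem_mulfs.
  exists (index y h3); last by rewrite /z nth_index.
  by rewrite (@leq_trans (size h3))// ?index_mem// (leq_trans _ hL)// size_filter count_size.
have E1 : 1%g \in E by rewrite memE powfs_id.
have L0 : (0 < L)%N.
  by have [p pL _] := zcov _ E1; exact: leq_ltn_trans pL.
pose W0 i := T (z (i %% L)%N)^-1%g @^-1`
  (if (i < Q * L)%N then U (i %/ L)%N else set0).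
exists (fun i => (W0 i)^°); split=> [i|i|x xgen].
- exact: open_interior.
- apply: (sub_no_returns (@interior_subset _ _)) => x e eE.
  rewrite /W0 /=; set p := (i %% L)%N; case: ltnP => // iQ Ux Ux'.
  have /UQ[UR _] : (i %/ L < Q)%N by rewrite ltn_divLR.
  have : ((z p)^-1 * e * z p)%g \in R.
    apply: (@powfsD _ A 5 3) => //; apply: (@powfsD _ A 3 2); first exact: powfsV.
    by rewrite -memE.
  move=> /UR /(_ Ux); rewrite !dynsys_actM actKV => /(_ Ux') zez.
  by apply: (conjg_inj (z p)); rewrite conj1g conjgE mulgA.
- have [q qQ [e eE Ux]] := nYU x (@Y0 x).
  have eVE : (e^-1)%g \in E by rewrite memE; apply: powfsV => //; rewrite -memE.
  have [p pL eA] := zcov _ eVE.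
  have iQL : (q * L + p < Q * L)%N.
    by apply: (@leq_trans (q.+1 * L)%N); rewrite ?leq_mul2r ?qQ ?orbT// mulSn addnC ltn_add2r.
  exists (q * L + p)%N => //; exists (e^-1 * (z p)^-1)%g => //.
  have [_ Udec] := UQ q qQ.
  have /decided_nbhs/(_ Ux) nbhsU : decided (U q) (T e x).
    by apply: Udec; apply: generic_act xgen; exact: ER.
  rewrite /interior /W0 iQL modnMDl modn_small// divnMDl// divn_small// addn0.
  apply: act_continuous; rewrite -dynsys_actM invgM !invgK mulKg.
  exact: nbhsU.
Qed.

End TowerFamily.

End Towers.

(** * Instability of common zeros in finite dimension *)

Section GeneralPosition.
Variable R : realType.

Lemma nonroot_ge (p : {poly R}) (z0 : R) :
  p != 0 -> exists2 z, z0 <= z & ~~ root p z.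
Proof.
move=> p0; apply: contrapT => nex.
pose s := [seq z0 + k%:R | k <- iota 0 (size p)].
have : (size s < size p)%N.
  apply: max_poly_roots => //.
    apply/allP => _ /mapP[k _ ->]; apply/negPn/negP => nroot.
    by apply: nex; exists (z0 + k%:R); rewrite // lerDl.
  rewrite map_inj_uniq ?iota_uniq// => k l /addrI /eqP.
  by rewrite eqr_nat => /eqP.
by rewrite size_map size_iota ltnn.
Qed.

(** Finitely many vectors of [R ^ m] become such that any [m] of them are
    independent after adding small multiples of points of the moment curve: the
    determinants in question are polynomials in the reciprocal [z] of the small
    factor, and they do not vanish at [z = 0], where they are
    Vandermonde determinants. *)
Lemma general_position (I : finType) m (q : I -> 'I_m -> R) (eps : R) :
  0 < eps -> exists p : I -> 'I_m -> R,
    (forall i l, `|p i l - q i l| <= eps) /\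
    forall c : I -> R, (#|[pred i | c i != 0%R]| <= m)%N ->
      (forall l, \sum_i c i * p i l = 0) -> forall i, c i = 0.
Proof.
move=> eps0.
pose u (i : I) : R := (enum_rank i)%:R.
pose q' i (b : nat) : R := oapp (q i) 0 (insub b).
pose V (S : {set I}) : 'M[R]_#|S| := \matrix_(a < #|S|, b < #|S|) u (enum_val a) ^+ b.
pose Q (S : {set I}) : 'M[R]_#|S| := \matrix_(a < #|S|, b < #|S|) q' (enum_val a) b.
pose P S := \det (map_mx polyC (V S) + 'X *: map_mx polyC (Q S)).
have PE S z : (P S).[z] = \det (V S + z *: Q S).
  rewrite -[LHS]/(horner_eval z (P S)) -det_map_mx; congr (\det _).
  by apply/matrixP => a b; rewrite !mxE /= /horner_eval !hornerE.
have P0 S : P S != 0.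
  have : (P S).[0] != 0; last by apply: contra_neq => ->; rewrite horner0.
  rewrite PE scale0r addr0.
  have -> : V S = (Vandermonde #|S| (\row_a u (enum_val a)))^T.
    by apply/matrixP => a b; rewrite !mxE.
  rewrite det_tr det_Vandermonde; apply/prodf_neq0 => a _.
  apply/prodf_neq0 => b ab; rewrite !mxE subr_eq0 eqr_nat.
  apply: contraTneq ab => /val_inj /enum_rank_inj /enum_val_inj ->.
  by rewrite ltnn.
pose M : R := #|I|.+1%:R ^+ m / eps.
have M0 : 0 < M by rewrite divr_gt0// exprn_gt0// ltr0n.
have prodP0 : \prod_S P S != 0 by apply/prodf_neq0 => S _.
have [z Mz] := nonroot_ge M prodP0.
rewrite /root horner_prod => /prodf_neq0 zP.
have z0 : 0 < z by exact: lt_le_trans Mz.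
exists (fun i l => q i l + z^-1 * u i ^+ l); split=> [i l|c cm csum i].
  rewrite [X in `|X|]addrC addKr ger0_norm; last first.
    by rewrite mulr_ge0 ?invr_ge0 ?(ltW z0)// exprn_ge0.
  rewrite ler_pdivrMl//; apply: (@le_trans _ _ (M * eps)); last first.
    by rewrite ler_wpM2r// ltW.
  rewrite /M mulfVK ?gt_eqF//.
  apply: (@le_trans _ _ (#|I|.+1%:R ^+ l)).
    by rewrite lerXn2r ?nnegrE// ler_nat ltnW// ltnS ltnW.
  by rewrite ler_weXn2l// ?ler1n// ltnW.
have [/eqP//|ci] := boolP (c i == 0).
pose S := [set i | c i != 0]%SET.
have Sm : (#|S| <= m)%N by rewrite /S cardsE.
pose w : 'rV[R]_#|S| := \row_a c (enum_val a).
have w0 : w = 0.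
  have Sunit : V S + z *: Q S \in unitmx by rewrite unitmxE unitfE -PE zP.
  rewrite -[w](mulmxK Sunit) -[RHS](mul0mx _ (invmx (V S + z *: Q S))).
  congr (_ *m _); apply/rowP => b; rewrite !mxE.
  have bm : (b < m)%N by apply: leq_trans (ltn_ord b) Sm.
  transitivity (z * \sum_i c i * (q i (Ordinal bm) + z^-1 * u i ^+ b)); last first.
    by have := csum (Ordinal bm); rewrite /= => ->; rewrite mulr0.
  rewrite mulr_sumr [RHS](bigID (mem S)) /= [X in _ = _ + X]big1 ?addr0; last first.
    by move=> j; rewrite inE negbK => /eqP ->; rewrite mul0r mulr0.
  rewrite [RHS]big_enum_val /=; apply: eq_bigr => a _; rewrite !mxE /q' insubT /=.
  by field; rewrite gt_eqF.
have iS : i \in S by rewrite inE.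
have := congr1 (fun w : 'rV_#|S| => w 0 (enum_rank_in iS i)) w0.
by rewrite !mxE enum_rankK_in.
Qed.

End GeneralPosition.

Lemma compact_nbhs_cover (X : topologicalType) (W : X -> set X) :
  compact [set: X] -> (forall x, nbhs x (W x)) ->
  exists D : {fset X}, forall y, exists2 x, x \in D & W x y.
Proof.
move=> Xc nW; apply: contrapT => nex.
pose out (D : {fset X}) : set X := [set y | forall x, x \in D -> ~ W x y].
pose F := filter_from setT out.
have FF : ProperFilter F.
  apply: filter_from_proper => [|D _]; last first.
    apply: contrapT => nD; apply: nex; exists D => y; apply: contrapT => ny.
    by apply: nD; exists y => x xD Wy; apply: ny; exists x.
  apply: filter_from_filter => [|D E _ _]; first by exists fset0.
  exists (D `|` E)%fset => // y yDE.
  by split=> x xD; apply: yDE; rewrite inE xD ?orbT.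
have [p [_ Fp]] := Xc F FF filterT.
have [|y [out_y Wy]] := Fp (out [fset p]%fset) (W p) _ (nW p).
  by exists [fset p]%fset.
by apply: (out_y p); rewrite ?inE.
Qed.

Lemma continuous_sum (R : realType) (X : topologicalType) (I : finType)
    (F : I -> X -> R) :
  (forall i, continuous (F i)) -> continuous (fun x => \sum_i F i x).
Proof. by move=> Fc; apply: continuous_big => //; exact: add_continuous. Qed.

Section Perturbation.
Variables (R : realType) (X : metricType R).
Hypothesis X_compact : compact [set: X].

Lemma mdist_continuous (x : X) : continuous (fun y => mdist x y : R).
Proof.
move=> y; apply/cvgrPdist_le => e e0.
apply: filterS (nbhsx_ballx y e e0) => z; rewrite ballEmdist /= => yz.
rewrite ler_norml lerBlDr lerBrDr.
have := metric_triangle x y z; have := metric_triangle x z y.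
rewrite (metric_sym z y); lra.
Qed.

(** A common zero of [d.+1] functions on a space of dimension at most [d] is
    unstable. The functions are replaced by interpolations on the nerve of a fine
    cover, with vertices in general position: at each point at most
    [d.+1] vertices are involved, so that their combination does not vanish. *)
Lemma no_common_zero d (f : 'I_d.+1 -> X -> R) (eps : R) :
  covering_dim_le X d -> (forall l, continuous (f l)) -> 0 < eps ->
  exists g : 'I_d.+1 -> X -> R,
    [/\ forall l, continuous (g l), forall l x, `|g l x - f l x| <= eps &
        forall x, exists l, g l x != 0].
Proof.
move=> dimX fc eps0; pose e := eps / 2.
have e0 : 0 < e by rewrite divr_gt0.
pose U : set (set X) :=
  [set O | open O /\ forall x y, O x -> O y -> forall l, `|f l x - f l y| <= e].
have [||V [Vopen VT VU Vmult]] := dimX U; first by move=> O [].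
  rewrite -subTset => x _.
  exists [set y | forall l, `|f l x - f l y| <= e / 2]^°.
    split=> [|y z /interior_subset /= yx /interior_subset /= zx l].
      exact: open_interior.
    rewrite -(subrKA (f l x)) (le_trans (ler_normD _ _))//.
    by rewrite [leRHS](splitr e) lerD// distrC.
  apply: filter_forall => l; move/cvgrPdist_le: (fc l x); apply.
  by rewrite divr_gt0.
have /choice [B BP] : forall x, exists b : set X * R,
    [/\ V b.1, b.1 x, 0 < b.2 & forall y, mdist x y < b.2 -> b.1 y].
  move=> x.
  have [W VW Wx] : (\bigcup_(W in V) W) x by rewrite VT.
  have /nbhs_ballP[r /= r0 rW] := open_nbhs_nbhs (conj (Vopen _ VW) Wx).
  by exists (W, r); split=> // y xy; apply: rW; rewrite ballEmdist.
have [D DX] : exists D : {fset X}, forall y,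
    exists2 x, x \in D & ball x (B x).2 y.
  by apply: compact_nbhs_cover => // x; case: (BP x) => _ _ r0 _; exact: nbhsx_ballx.
pose lam (i : D) y : R := Num.max 0 ((B (val i)).2 - mdist (val i) y).
pose v (i : D) : set X := (B (val i)).1.
have lam_ge0 i y : 0 <= lam i y by rewrite /lam le_max lexx.
have lam_v i y : lam i y != 0 -> v i y.
  move=> lam0; have : 0 < lam i y by rewrite lt_neqAle eq_sym lam0 lam_ge0.
  rewrite /lam lt_max ltxx /= subr_gt0 /v; case: (BP (val i)) => _ _ _; exact.
have lam_c i : continuous (lam i).
  move=> y; apply: (@continuous_max R X (fun=> 0)
    (fun y => (B (val i)).2 - mdist (val i) y)); first exact: cvg_cst.
  by apply: cvgB; [exact: cvg_cst|exact: mdist_continuous].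
pose Lam y := \sum_i lam i y.
have Lam0 y : 0 < Lam y.
  have [x xD] := DX y; rewrite ballEmdist /= => xy.
  rewrite /Lam (bigD1 [` xD]%fset)//= ltr_wpDr ?sumr_ge0//.
  by rewrite /lam /= lt_max subr_gt0 xy orbT.
have Lam_c : continuous Lam.
  exact: continuous_sum.
(* one representative for all indices with the same member of the cover *)
pose rep i := odflt i [pick j | `[< v j = v i >]].
have v_rep i : v (rep i) = v i.
  by rewrite /rep; case: pickP => [j /asboolP|].
have rep_eq i j : v i = v j -> rep i = rep j.
  move=> vij; rewrite /rep.
  under eq_pick => k do rewrite vij.
  by case: pickP => // /(_ j); rewrite asboolT.
have [p [pq pind]] := general_position (fun (i : D) l => f l (val i)) e0.
exists (fun l y => (\sum_i lam i y * p (rep i) l) / Lam y); split=> [l y|l y|y].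
- apply: cvgM; last by apply: cvgV; [rewrite gt_eqF|exact: Lam_c].
  apply: (@continuous_sum _ _ _ (fun i y => lam i y * p (rep i) l)) => i z.
  by apply: cvgM; [exact: lam_c|exact: cvg_cst].
- have -> : f l y = (\sum_i lam i y * f l y) / Lam y.
    by rewrite -mulr_suml -/(Lam y) mulrAC mulfV ?mul1r// gt_eqF.
  rewrite -mulrBl -sumrB normrM [X in _ * X]gtr0_norm ?invr_gt0//.
  rewrite ler_pdivrMr// mulr_sumr (le_trans (ler_norm_sum _ _ _))//.
  apply: ler_sum => i _; rewrite -mulrBr normrM ger0_norm// mulrC.
  have [->|/lam_v viy] := eqVneq (lam i y) 0; first by rewrite !mulr0.
  rewrite ler_wpM2r// -(subrKA (f l (val (rep i)))) (le_trans (ler_normD _ _))//.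
  rewrite (splitr eps) lerD//.
  case: (BP (val (rep i))) => /VU[W [_ WU] vW] vrep _ _.
  by apply: WU; apply: vW => //; rewrite -/(v (rep i)) v_rep.
- pose c i := \sum_(j | rep j == i) lam j y.
  have c_v i : c i != 0 -> rep i = i /\ v i y.
    have [/existsP[j /andP[/eqP ji /lam_v vj]] _|/existsPn nex] :=
        boolP [exists j, (rep j == i) && (lam j y != 0)].
      have vij : v i = v j by rewrite -ji v_rep.
      by split; [rewrite (rep_eq _ _ vij)|rewrite vij].
    rewrite /c big1 ?eqxx// => j ji.
    by have := nex j; rewrite ji /= negbK => /eqP.
  have cm : (#|[pred i | c i != 0%R]| <= d.+1)%N.
    have [k k_inj k_lt] : exists2 k : set X -> nat,
        {in [set W | V W /\ W y] &, injective k} &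
        forall W, V W -> W y -> (k W < d.+1)%N.
      have /pcard_leP[k] := Vmult y; exists k => [|W VW Wy]; first exact: inj.
      by apply: (@funS _ _ _ _ k).
    rewrite cardE -(size_map (fun i => k (v i))) -(size_iota 0 d.+1).
    have Vv i : V (v i) by case: (BP (val i)).
    apply: uniq_leq_size => [|_ /mapP[i + ->]]; last first.
      by rewrite mem_enum inE => /c_v[_ viy]; rewrite mem_iota k_lt.
    rewrite map_inj_in_uniq ?enum_uniq// => i j.
    rewrite !mem_enum !inE => /c_v[ri vi] /c_v[rj vj] kij.
    by rewrite -ri -rj; apply/rep_eq/k_inj => //; apply/mem_set; split.
  apply: contrapT => /forallNP nex.
  have /(pind _ cm) c0 : forall l, \sum_i c i * p i l = 0.
    move=> l; have /negP/negPn := nex l.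
    rewrite mulf_eq0 invr_eq0 (gt_eqF (Lam0 y)) orbF => /eqP sum0.
    apply: etrans sum0; rewrite [RHS](partition_big rep xpredT)//=; apply: eq_bigr => i _.
    by rewrite mulr_suml; apply: eq_bigr => j /eqP <-.
  have := Lam0 y; rewrite /Lam (partition_big rep xpredT)//= big1 ?ltxx// => i _.
  exact: c0.
Qed.

End Perturbation.

(** * Finite Rokhlin dimension *)

Section Assembly.
Variables (R : realType) (X : metricType R) (Gamma : groupType).
Hypothesis X_compact : compact [set: X].
Variable T : dynsys X Gamma.

Lemma positive_lower_bound (I : eqType) (s : seq I) (r : I -> R) :
  (forall i, 0 < r i) -> exists2 e, 0 < e & forall i, i \in s -> e <= r i.
Proof.
move=> r0; elim: s => [|i s [e e0 es]]; first by exists 1.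
exists (Num.min (r i) e) => [|j]; first by rewrite lt_min r0.
by rewrite inE => /predU1P[->|/es je]; rewrite ge_min ?lexx// je orbT.
Qed.

Lemma no_common_zero_margin m (g : 'I_m -> X -> R) :
  (forall l, continuous (g l)) -> (forall x, exists l, g l x != 0) ->
  exists2 e, 0 < e & forall x, exists l, e <= `|g l x|.
Proof.
move=> gc /choice[l gl].
have r0 x : 0 < `|g (l x) x| / 2 by rewrite divr_gt0// normr_gt0.
have [D DX] : exists D : {fset X}, forall y, exists2 x, x \in D &
    `|g (l x) x - g (l x) y| <= `|g (l x) x| / 2.
  apply: compact_nbhs_cover => // x.
  by move/cvgrPdist_le : (gc (l x) x); apply.
have [e e0 eD] := positive_lower_bound (enum_fset D) r0.
exists e => // y; have [x xD xy] := DX y; exists (l x).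
apply: le_trans (eD x xD) _.
have := ler_normD (g (l x) x - g (l x) y) (g (l x) y); rewrite subrK.
by move: xy; lra.
Qed.

(** Perturbing one function of each of [d.+1] families removes the common zeros
    of one tuple of translates. By compactness these stay removed under further
    small perturbations, so that finitely many tuples can be treated in turn. *)
Lemma generic_families d K (S : {fset Gamma}) (f : 'I_d.+1 -> 'I_K -> X -> R)
    (eps : R) :
  covering_dim_le X d -> (forall l j, continuous (f l j)) -> 0 < eps ->
  exists f' : 'I_d.+1 -> 'I_K -> X -> R,
    [/\ forall l j, continuous (f' l j),
        forall l j x, `|f' l j x - f l j x| <= eps &
        forall x (g : 'I_d.+1 -> Gamma) (j : 'I_d.+1 -> 'I_K),
          (forall l, g l \in S) -> exists l, f' l (j l) (T (g l) x) != 0].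
Proof.
move=> dimX fc eps0.
pose val_at (f' : 'I_d.+1 -> 'I_K -> X -> R)
  (t : {ffun 'I_d.+1 -> S * 'I_K}) l x := f' l (t l).2 (T (val (t l).1) x).
suff [f' [f'c f'f [e e0 ef']]] : exists f' : 'I_d.+1 -> 'I_K -> X -> R,
    [/\ forall l j, continuous (f' l j),
        forall l j x, `|f' l j x - f l j x| <= eps &
        exists2 e, 0 < e & forall t, t \in enum {ffun 'I_d.+1 -> S * 'I_K} ->
          forall x, exists l, e <= `|val_at f' t l x|].
  exists f'; split=> // x g j gS.
  have [l le_l] := ef' [ffun l => ([` gS l]%fset, j l)] (mem_enum _ _) x.
  exists l; rewrite -normr_gt0; apply: lt_le_trans e0 _.
  by move: le_l; rewrite /val_at ffunE.
elim: (enum _) eps eps0 => [|t s IHs] eps eps0.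
  exists f; split=> // [l j x|]; first by rewrite subrr normr0 ltW.
  by exists 1.
have eps20 : 0 < eps / 2 by rewrite divr_gt0.
have [f1 [f1c f1f [e1 e10 ef1]]] := IHs _ eps20.
have gc l : continuous (val_at f1 t l).
  move=> x; apply: continuous_comp; last exact: f1c.
  exact: act_continuous.
pose eta := Num.min (eps / 2) (e1 / 2).
have eta0 : 0 < eta by rewrite lt_min eps20 divr_gt0.
have [g [g_c g_near g_nz]] := no_common_zero X_compact dimX gc eta0.
have [e2 e20 eg] := no_common_zero_margin g_c g_nz.
pose f2 l j := if j == (t l).2 then g l \o T (val (t l).1)^-1%g else f1 l j.
have f2f1 l j x : `|f2 l j x - f1 l j x| <= eta.
  rewrite /f2; case: eqP => [->|_]; last by rewrite subrr normr0 ltW.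
  by have := g_near l (T (val (t l).1)^-1%g x); rewrite /val_at actKV.
exists f2; split=> [l j|l j x|].
- rewrite /f2; case: eqP => _ //; move=> x.
  by apply: continuous_comp; [exact: act_continuous|exact: g_c].
- rewrite -(subrKA (f1 l j x)) (le_trans (ler_normD _ _))// (splitr eps) lerD//.
  by apply: le_trans (f2f1 l j x) _; rewrite ge_min lexx.
exists (Num.min (e1 / 2) e2) => [|u]; first by rewrite lt_min e20 divr_gt0.
rewrite inE => /predU1P[->|us] x.
  have [l gl] := eg x; exists l; rewrite ge_min; apply/orP; right.
  by rewrite /val_at /f2 eqxx /= actK.
have [l le_l] := ef1 u us x; exists l; rewrite ge_min; apply/orP; left.
have := f2f1 l (u l).2 (T (val (u l).1) x); rewrite le_min => /andP[_].
have := ler_normD (f1 l (u l).2 (T (val (u l).1) x) - f2 l (u l).2 (T (val (u l).1) x))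
  (f2 l (u l).2 (T (val (u l).1) x)).
by rewrite subrK distrC; move: le_l; rewrite /val_at; lra.
Qed.

Lemma free_nbhs (S : {fset Gamma}) (x : X) : free_system T ->
  exists2 C : set X, nbhs x C & no_returns T S C.
Proof.
move=> Tfree; suff [C nC CS] : exists2 C : set X, nbhs x C &
    forall y r, r \in enum_fset S -> C y -> C (T r y) -> r = 1%g by exists C.
elim: (enum_fset S) => [|r s [C nC CS]]; first by exists setT => //; exact: filterT.
have [r1|r1] := pselect (r = 1%g).
  exists C => // y q; rewrite inE => /predU1P[->//|]; exact: CS.
have rho0 : 0 < mdist x (T r x) by rewrite mdist_gt0; apply/eqP => xr; exact: (Tfree x r).
set rho := mdist x (T r x) in rho0 *; have rho20 : 0 < rho / 2 by rewrite divr_gt0.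
exists (C `&` (ball x (rho / 2) `&` T r @^-1` ball (T r x) (rho / 2))).
  apply: filterI => //; apply: filterI; first exact: nbhsx_ballx.
  by apply: act_continuous; exact: nbhsx_ballx.
move=> y q + [Cy [xy rxy]] [Cqy [xqy _]]; rewrite inE => /predU1P[qr|qs]; last first.
  exact: CS qs Cy Cqy.
move: rxy xqy; rewrite qr !ballEmdist /= => rxy xqy; exfalso.
have := metric_triangle x (T r y) (T r x); rewrite (metric_sym (T r y)) -/rho.
by move: rxy xqy; lra.
Qed.

(** Sets without returns around every point, as superlevel sets which leave room
    for a perturbation by [1]. *)
Lemma small_cover (S : {fset Gamma}) : free_system T ->
  exists K (f : 'I_K -> X -> R), [/\ forall j, continuous (f j),
    forall x, exists j, 1 < f j x &
    forall j, no_returns T S [set x | - 1 < f j x]].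
Proof.
move=> Tfree.
have /choice [r rP] : forall x, exists r : R,
    0 < r /\ no_returns T S (ball x (3 * r)).
  move=> x; have [C /nbhs_ballP[e /= e0 eC] CS] := free_nbhs S x Tfree.
  exists (e / 3); split; first by rewrite divr_gt0.
  by apply: sub_no_returns CS; rewrite mulrC divfK.
have [D DX] : exists D : {fset X}, forall y, exists2 x, x \in D & ball x (r x) y.
  by apply: compact_nbhs_cover => // x; apply: nbhsx_ballx; case: (rP x).
pose c (j : 'I_#|{: D}|) : X := val (enum_val j).
exists #|{: D}|, (fun j y => 2 - mdist (c j) y / r (c j)); split=> [j x|x|j].
- apply: cvgB; first exact: cvg_cst.
  by apply: cvgM; [exact: mdist_continuous|exact: cvg_cst].
- have [y yD] := DX x; rewrite ballEmdist /= => yx.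
  exists (enum_rank [` yD]%fset); rewrite /c enum_rankK /=.
  have [ry0 _] := rP y.
  have : mdist y x / r y < 1 by rewrite ltr_pdivrMr// mul1r.
  by lra.
- have [rj0 rj] := rP (c j); apply: sub_no_returns rj => y /= fy.
  rewrite ballEmdist /=; have : mdist (c j) y / r (c j) < 3 by lra.
  by rewrite ltr_pdivrMr.
Qed.

(** By compactness the open bases still cover after removing a collar of uniform
    width [e] around their complements, and then their closures stay inside. *)
Lemma shrink_towers m (A : {fset Gamma}) (W : 'I_m -> set X) :
  (forall i, open (W i)) ->
  (forall x, exists i, exists2 a, a \in A & W i (T a^-1%g x)) ->
  exists U : 'I_m -> set X,
    [/\ forall i, open (U i), forall i, closure (U i) `<=` W i &
        forall x, exists i, exists2 a, a \in A & U i (T a^-1%g x)].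
Proof.
move=> Wopen Wcov.
have /choice [p pP] : forall x, exists p : 'I_m * Gamma * R,
    [/\ p.1.2 \in A, 0 < p.2 &
        ball (T p.1.2^-1%g x) (p.2 + p.2) `<=` W p.1.1].
  move=> x; have [i [a aA Wx]] := Wcov x.
  have /nbhs_ballP[r /= r0 rW] := open_nbhs_nbhs (conj (Wopen i) Wx).
  by exists (i, a, r / 2); split; rewrite //= ?divr_gt0// -splitr.
have p0 x : 0 < (p x).2 by case: (pP x).
pose B x := (ball (T (p x).1.2^-1%g x) (p x).2)^°.
have [D DX] : exists D : {fset X}, forall y, exists2 x, x \in D &
    (T (p x).1.2^-1%g @^-1` B x) y.
  apply: compact_nbhs_cover => // x; apply: act_continuous.
  exact: (nbhs_interior (nbhsx_ballx _ _ (p0 x))).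
have [e e0 eD] := positive_lower_bound (enum_fset D) p0.
pose U i : set X := [set y | ball y e `<=` W i]^°.
exists U; split=> [i|i y Uy|y].
- exact: open_interior.
- have [z [/interior_subset zW yz]] := Uy _ (nbhsx_ballx y e e0).
  by apply: zW; exact: ball_sym.
- have [x xD xy] := DX y; have [aA _ xW] := pP x.
  exists (p x).1.1, (p x).1.2 => //; apply: filterS xy => z xz w zw.
  by apply/xW/(ball_triangle xz)/(le_ball (eD x xD)).
Qed.

(** Each of [d.+1] independent families gives towers which cover all points that
    are generic for it, and every point is generic for one of the families: the
    families fail at a common point only if [d.+1] functions, one of
    each family, have a common zero among finitely many translates. *)
Lemma towers_cover d L (A : {fset Gamma}) :
  free_system T -> covering_dim_le X d -> 1%g \in A ->
  (forall a, a \in A -> (a^-1)%g \in A) -> doubling A L ->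
  exists U : 'I_(d.+1 * ((L ^ 8).+1 * L)) -> set X,
    [/\ forall i, open (U i),
        forall i, no_returns T (mulfs A A) (closure (U i)) &
        forall x, exists i, exists2 a, a \in A & U i (T a^-1%g x)].
Proof.
move=> Tfree dimX A1 AV [h hL hcov]; set N := ((L ^ 8).+1 * L)%N.
have [K [f0 [f0c f0cov f0R]]] := small_cover (powfs A 8) Tfree.
pose S := powfs (powfs A 8) (tower_level L K).
have [f [fc ff0 fS]] :=
  generic_families S dimX (fun (_ : 'I_d.+1) j => f0c j) ltr01.
pose V l j : set X := [set x | exists2 i : 'I_K, i = j :> nat & 0 < f l i x].
have V_R l j : (j < K)%N -> no_returns T (powfs A 8) (V l j).
  move=> jK; apply: sub_no_returns (f0R (Ordinal jK)) => x [i ij fx] /=.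
  have <- : i = Ordinal jK by exact: val_inj.
  by have := ff0 l i x; rewrite ler_norml => /andP[]; lra.
have V_cov l x : exists2 j, (j < K)%N & V l j x.
  have [j fj] := f0cov x; exists j => //; exists j => //.
  by have := ff0 l j x; rewrite ler_norml => /andP[]; lra.
have /choice [W WP] : forall l, exists W : nat -> set X,
  [/\ forall i, open (W i),
      forall i, no_returns T (mulfs A A) (W i) &
      forall x, generic T (powfs A 8) (V l) K (tower_level L K) x ->
        exists2 i, (i < N)%N & exists2 a, a \in A & W i (T a^-1%g x)].
  by move=> l; exact: (tower_family A1 AV hL hcov (V_R l) (V_cov l)).
(* the sets of a family have their boundary in the zeros of its functions *)
have gen x : exists l, generic T (powfs A 8) (V l) K (tower_level L K) x.
  apply: contrapT => /forallNP ngen.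
  have /choice [gj gjP] : forall l, exists gj : Gamma * 'I_K,
      gj.1 \in S /\ f l gj.2 (T gj.1 x) = 0.
    move=> l; apply: contrapT => /forallNP nz; apply: (ngen l) => g gS j jK.
    have : f l (Ordinal jK) (T g x) != 0.
      by apply/eqP => fz; exact: nz (g, Ordinal jK) (conj gS fz).
    have VE : V l j = [set y | 0 < f l (Ordinal jK) y].
      apply/seteqP; split=> [y [i ij fy]|y fy]; last by exists (Ordinal jK).
      by have <- : i = Ordinal jK by exact: val_inj.
    rewrite VE neq_lt => /orP[neg|pos]; [right|left].
      have fneg : nbhs (T g x) [set y | f l (Ordinal jK) y < 0].
        exact: (fc l (Ordinal jK) (T g x) _ (lt_nbhsl neg)).
      by apply: filterS fneg => y /= fy /lt_trans/(_ fy); rewrite ltxx.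
    exact: (fc l (Ordinal jK) (T g x) _ (lt_nbhsr pos)).
  have [l] := fS x (fun l => (gj l).1) (fun l => (gj l).2) (fun l => (gjP l).1).
  by rewrite (gjP l).2 eqxx.
have [|x|U [Uopen UW Ucov]] := @shrink_towers (d.+1 * N) A
    (fun i => W (inord (i %/ N)%N) (i %% N)%N).
- by move=> i; case: (WP (inord (i %/ N)%N)).
- have [l /(_ _ _ _)] := gen x; case: (WP l) => _ _ /[apply] -[p pN Wp].
  have iN : (l * N + p < d.+1 * N)%N.
    apply: (@leq_trans (l.+1 * N)%N); last by rewrite leq_mul2r ltn_ord orbT.
    by rewrite mulSn addnC ltn_add2r.
  have N0 : (0 < N)%N by exact: leq_ltn_trans pN.
  exists (Ordinal iN) => /=.
  by rewrite divnMDl// divn_small// addn0 modnMDl modn_small// inord_val.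
exists U; split=> // i; apply: sub_no_returns (UW i) _.
by case: (WP (inord (i %/ N)%N)).
Qed.

Lemma rokhlin_dim_finite : doubling_folner Gamma R ->
  finite_covering_dim X -> free_system T -> (rokhlin_dim R T < +oo)%E.
Proof.
move=> [F [L [FF FV FL]]] [d dimX] Tfree; have [_ F1 _ _] := FF.
pose N := (d.+1 * ((L ^ 8).+1 * L))%N.
apply: (@le_lt_trans _ _ N%:R%:E); last exact: ltry.
apply: ereal_inf_lbound; exists N => //; exists F => // n.
have [U [Uopen UR Ucov]] := towers_cover Tfree dimX (F1 n) (FV n) (FL n).
exists (fun i => if insub (i : nat) is Some j then U j else set0); split.
- by move=> i; case: insub => [j|]; [exact: Uopen|exact: open0].
- move=> i g h gF hF; case: insub => [j|]; last first.
    by move=> [x [[y]]]; rewrite closure0.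
  move=> [_ [[y Uy <-] [z Uz zy]]].
  have zE : z = T (h^-1 * g)%g y by rewrite dynsys_actM -zy actK.
  have : (h^-1 * g)%g \in mulfs (F n) (F n) by apply: mem_mulfs => //; exact: FV.
  move=> /(UR j y)/(_ Uy); rewrite -zE => /(_ Uz) hg.
  by rewrite -(mulVKg h g) hg mulg1.
- rewrite -subTset => x _; have [j [a aF Ux]] := Ucov x.
  exists (widen_ord (leqnSn N) j) => //; exists a => //.
  exists (T a^-1%g x); last exact: actKV.
  by rewrite /= insubT //= => jN; congr U: Ux; exact: val_inj.
Qed.

End Assembly.

Theorem corollary4p2p4 (R : realType) (n : nat) (n_ge1 : (1 <= n)%N)
    (X : metricType R) (X_compact : compact [set: X])
    (X_dim : finite_covering_dim X)
    (G : groupType) (G_countable : countable [set: G])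
    (G_class : [\/ finite_set [set: G],
                   fin_gen G /\ is_abelian G,
                   locally_finite G |
                   exists F : nat -> {fset G},
                     WAFC R F /\ symmetric_sequence F])
    (T : dynsys X (heisenberg n * G)%type) (T_free : free_system T) :
  (rokhlin_dim R T < +oo)%E.
Proof.
apply: rokhlin_dim_finite => //.
apply: doubling_folnerM; first exact: heisenberg_doubling.
case: G_class => [Gfin|[Gfg Gab]|Glf|[F [FW Fsym]]].
- exact/locally_finite_doubling/finite_locally_finite.
- exact: fin_gen_abelian_doubling.
- exact: locally_finite_doubling.
- exact: WAFC_doubling FW Fsym.
Qed.
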